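(* Let $n(r)$ be the number of zeroes of the planar Gaussian analytic function $\mathbf{g}$ in the disk of radius $r$ around $0$. Fix $1<\alpha<2$. Then for any $\gamma>0$, as $r\to\infty$, $$\mathbf{P}\left[n(r)\ge r^2+\gamma r^{\alpha}\right]\ge e^{-\gamma^3 r^{3\alpha-2}(1+o(1))}.$$
   Context: A standard complex normal random variable has density $\frac1\pi e^{-|z|^2}$ on $\mathbb{C}$. The planar Gaussian analytic function is the random entire function $\mathbf{g}(z)=\sum_{n=0}^{\infty}\frac{a_n z^n}{\sqrt{n!}}$, where $a_n$, $n\ge 0$, are i.i.d. standard complex normal random variables. *)

(* Defs.v *)
From HB Require Import structures.
From mathcomp Require Import all_boot all_order all_algebra.
From mathcomp Require Export complex.
From mathcomp Require Export all_classical all_reals all_analysis.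

Set Implicit Arguments.
Unset Strict Implicit.
Unset Printing Implicit Defensive.

Import Order.TTheory GRing.Theory Num.Theory.
Import numFieldNormedType.Exports.

Local Open Scope classical_set_scope.
Local Open Scope complex_scope.
Local Open Scope ring_scope.

Definition power_series_sum (K : numFieldType) (c : nat -> K) (z : K) : K :=
  limn (series (fun n => c n * z ^+ n)).

(* Equal to 0 when f z != 0, and to +oo when all derivatives of f vanish
   at z. *)
Definition vanishing_order (R : realType) (K : numFieldType) (f : K -> K)
    (z : K) : \bar R :=
  ereal_sup [set m%:R%:E | m in [set m : nat |
    forall j, (j < m)%N -> derive1n j f z = 0]].

(* Zeros are counted with multiplicity, in the open disk. *)
Definition zero_count (R : realType) (f : R[i] -> R[i]) (r : R) : \bar R :=
  \esum_(z in [set z : R[i] | `|z| < r%:C]) vanishing_order R f z.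

(* Borel sets of C are those of R x R. *)
Definition complex_coord (R : realType) (z : R[i]) :
    measurableTypeR R * measurableTypeR R :=
  (complex.Re z, complex.Im z).

Section complex_random_variables.
Context (d : measure_display) (T : measurableType d) (R : realType).
Implicit Types (P : probability T R).

Definition standard_complex_normal P (X : T -> R[i]) : Prop :=
  measurable_fun setT (@complex_coord R \o X) /\
  forall B : set (measurableTypeR R * measurableTypeR R), measurable B ->
    P ((@complex_coord R \o X) @^-1` B) =
    (\int[@lebesgue_measure R \x @lebesgue_measure R]_(x in B)
      (pi^-1 * expR (- (x.1 ^+ 2 + x.2 ^+ 2)))%:E)%E.

Definition mutually_independent P (X : nat -> T -> R[i]) : Prop :=
  forall (J : seq nat) (B : nat -> set (measurableTypeR R * measurableTypeR R)),
    uniq J -> (forall i, measurable (B i)) ->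
    P (\bigcap_(i in [set` J]) ((@complex_coord R \o X i) @^-1` B i)) =
    (\prod_(i <- J) P ((@complex_coord R \o X i) @^-1` B i))%E.

(* The series almost surely converges at every point; where it diverges,
   limn returns its default value 0. *)
Definition planar_GAF (a : nat -> T -> R[i]) (w : T) : R[i] -> R[i] :=
  power_series_sum (fun n => a n w / (Num.sqrt (n`!%:R))%:C).

End complex_random_variables.

(* Main.v *)
Require Import Defs.
From HB Require Import structures.
From mathcomp Require Import all_boot all_order all_algebra.
From mathcomp Require Import all_classical all_reals all_analysis.
From mathcomp Require Import measurable_realfun.
From mathcomp Require Import zify ring lra.

(** Put b_n = r^n / sqrt(n!), so that the n-th term of the series has modulus
    |a_n| b_n on the circle |z| = r, and let N be r^2 + gamma r^alpha rounded
    up to an integer. The weights b_n peak near n = r^2, and N lies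
    beyond the peak. Ask that |a_N| >= 1 and that |a_n| <= w_n b_N / b_n for all
    other n, where the shares w_n = 1 / ((n+1)(n+2)) add up to 1. On this event
    the N-th term exceeds the sum of all the others on the circle, and then the
    function has at least N zeros in the disk ([dominant_event_zeros]).

    The probability of the event is a product over n. Since
    P(|a_n| <= s) >= s^2 / 8 for s <= 1, the index n = N - k contributes to the
    negative logarithm about
    log (b_n^2 / b_N^2) <= k (V - k) / (2 r^2),   V = 2 (N - r^2) + 1,
    when this is positive, plus O(log r). This concerns the O(r^alpha) indices
    in a window around N; outside the window the thresholds are so large that
    the factors multiply to at least 1/2. The sum of the positive parts is about
    V^3 / (12 r^2), that is (2/3) gamma^3 r^(3 alpha - 2), and the window costs
    O(r^alpha log r), which is of smaller order because alpha > 1. As 2/3 < 1,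
    the claim holds for large r with error term 0 ([overcrowding_at_radius],
    [cost_le]).

    Zeros of power series are handled by division: [quot c l] is the sequence
    of coefficients of (f(z) - f(l)) / (z - l) if f has coefficients c. A zero
    at l is divided out, lowering the zero count by one, so that counting k
    zeros means dividing k times ([zero_count_geP]). The quotient depends
    continuously on c and l, and by compactness of closed disks the coefficient
    sequences with k zeros in a closed disk form a closed set
    ([approx_zeros_closed]). It follows that a dominant coefficient has to be
    exploited for polynomials only. There, if p had fewer than N roots in the
    disk, then p = q h with deg q < N and the roots of h outside; the power
    series u = 1/h has bounded coefficients (in the weight r^n), p u = q has no
    coefficient of index N or more, and the dominance of p_N in these equations
    forces u = 0 ([dominant_coefficient_roots]).

    The event that the count is at least x must be shown measurable before its
    probability can be compared to that of a smaller event
    ([measurable_zero_count_ge]). If the radius of convergence is less than r,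
    the sum is 0 on an annulus and the count is infinite. Otherwise, by the same
    continuity and compactness, k zeros exist exactly when truncations of the
    series have k approximate zeros at rational points, and this is a countable
    combination of conditions on finitely many coefficients. *)

Set Implicit Arguments.
Unset Strict Implicit.
Unset Printing Implicit Defensive.

Import Order.TTheory GRing.Theory Num.Theory.
Import numFieldNormedType.Exports.
Import Normc.

Local Open Scope classical_set_scope.
Local Open Scope ring_scope.

(** * Power series with complex coefficients and division by linear factors *)

Section complex_norm.
Context (R : realType).
Local Notation C := (Num.NumField.sort (complex_complex__canonical__Num_NumField R)).
Implicit Types (z : C) (u : nat -> C).

Lemma norm_normc z : `|z| = (normc z)%:C%C.
Proof. rewrite normc_def; case: z => a b; reflexivity. Qed.

Lemma normc_ge0 z : 0 <= normc z.
Proof. by rewrite -ler0c -norm_normc normr_ge0. Qed.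

(** Some rules for the real modulus are restated for the [numFieldType]
    structure of R[i], the one that carries the topology. *)
Lemma normCM z1 z2 : normc (z1 * z2) = normc z1 * normc z2.
Proof. exact: normcM. Qed.

Lemma normCN z : normc (- z) = normc z.
Proof. exact: normcN. Qed.

Lemma ler_normcD z1 z2 : normc (z1 + z2) <= normc z1 + normc z2.
Proof. exact: le_normcD. Qed.

Lemma normcB z1 z2 : normc (z1 - z2) = normc (z2 - z1).
Proof. by rewrite -(normCN (z1 - z2)) opprB. Qed.

Lemma normcX z n : normc (z ^+ n) = normc z ^+ n.
Proof.
elim: n => [|n IH]; first by rewrite !expr0 normc1.
by rewrite !exprS normCM IH.
Qed.

Lemma normc_real (x : R) : normc x%:C%C = `|x|.
Proof. by rewrite /= expr0n addr0 sqrtr_sqr. Qed.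

Lemma normc_sqr z : normc z ^+ 2 = complex.Re z ^+ 2 + complex.Im z ^+ 2.
Proof. by case: z => a b /=; rewrite sqr_sqrtr // addr_ge0 ?sqr_ge0. Qed.

Lemma normc_gtRe z : `|complex.Re z| <= normc z.
Proof.
by rewrite -(ler_pXn2r (n:=2)) ?nnegrE ?normc_ge0 // normc_sqr real_normK ?num_real // lerDl sqr_ge0.
Qed.

Lemma normc_gtIm z : `|complex.Im z| <= normc z.
Proof.
by rewrite -(ler_pXn2r (n:=2)) ?nnegrE ?normc_ge0 // normc_sqr real_normK ?num_real // lerDr sqr_ge0.
Qed.

Lemma normc_leD z : normc z <= `|complex.Re z| + `|complex.Im z|.
Proof.
rewrite -(ler_pXn2r (n:=2)) ?nnegrE ?normc_ge0 ?addr_ge0 // normc_sqr.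
rewrite sqrrD !real_normK ?num_real // -subr_ge0.
have -> : forall a b c : R, a + c *+2 + b - (a + b) = c *+ 2 by move=> *; ring.
by rewrite mulrn_wge0 // mulr_ge0.
Qed.

Lemma normc_sum (I : Type) (s : seq I) (P : pred I) (F : I -> C) :
  normc (\sum_(i <- s | P i) F i) <= \sum_(i <- s | P i) normc (F i).
Proof.
elim/big_ind2: _ => [|x1 x2 y1 y2 h1 h2|//]; first by rewrite normc0.
by apply: le_trans (ler_normcD _ _) _; apply: lerD.
Qed.

Lemma cvg_normcP (T : Type) (F : set_system T) (FF : Filter F) (f : T -> C) (l : C) :
  f x @[x --> F] --> l <->
  (forall e : R, 0 < e -> \forall x \near F, normc (f x - l) < e).
Proof.
split=> [/cvgrPdist_lt H e e0|H].
  have : 0 < e%:C%C :> R[i] by rewrite ltcR.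
  move=> /H; apply: filterS => x.
  by rewrite norm_normc ltcR normcB.
apply/cvgrPdist_lt => e e0.
have ee : e = (complex.Re e)%:C%C.
  by rewrite RRe_real // realE ltW.
have re : 0 < complex.Re e by rewrite -ltcR -ee.
move: (H _ re); apply: filterS => x.
by rewrite norm_normc ee ltcR normcB.
Qed.

Lemma cvg_normc_le (u : nat -> C) (l : C) (M : R) : u n @[n --> \oo] --> l ->
  (forall n, normc (u n) <= M) -> normc l <= M.
Proof.
move=> /cvg_normcP H uM; rewrite leNgt; apply/negP => Ml.
have /H : 0 < normc l - M by rewrite subr_gt0.
case=> n _ /(_ n (leqnn n)) /= h.
have := ler_normcD (l - u n) (u n); rewrite subrK => h2.
have := uM n; move: h; rewrite normcB => h h3; lra.
Qed.

Lemma cvg_complex (a b : nat -> R) (x y : R) :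
  a n @[n --> \oo] --> x -> b n @[n --> \oo] --> y ->
  (Complex (a n) (b n) : C) @[n --> \oo] --> (Complex x y : C).
Proof.
move=> /cvgrPdist_lt ha /cvgrPdist_lt hb; apply/cvg_normcP => e e0.
have e2 : 0 < e / 2 by lra.
near=> n.
apply: le_lt_trans (normc_leD _) _ => /=.
have h1 : `|x - a n| < e / 2 by near: n; apply: ha.
have h2 : `|y - b n| < e / 2 by near: n; apply: hb.
by rewrite distrC (distrC (b n)); lra.
Unshelve. all: by end_near. Qed.

End complex_norm.
Arguments cvg_normcP {R T F FF f l}.

Section power_series.
Context (R : realType).
Local Notation C := (Num.NumField.sort (complex_complex__canonical__Num_NumField R)).
Implicit Types (z l m : C) (c d : nat -> C) (rho s B : R).

Definition weight_bounded rho B c := forall n, normc (c n) * rho ^+ n <= B.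

(** The coefficients of (f(z) - f(l)) / (z - l), where f is the sum of the
    power series with coefficients [c]. *)
Definition quot c l : nat -> C :=
  fun k => power_series_sum (fun j => c (k.+1 + j)%N) l.

Definition shift c : nat -> C := fun n => c n.+1.

Lemma weight_bounded_ge0 rho B c : weight_bounded rho B c -> 0 <= B.
Proof. by move/(_ 0%N); rewrite expr0 mulr1; apply: le_trans; apply: normc_ge0. Qed.

(** Comparison with a geometric series, separately for the real and the
    imaginary parts. *)
Lemma psum_cvg rho B c z : weight_bounded rho B c -> normc z < rho ->
  cvgn (series (fun n => c n * z ^+ n)).
Proof.
move=> wb zr.
have r0 : 0 < rho by apply: le_lt_trans zr; apply: normc_ge0.
set q := normc z / rho.
have q1 : `|q| < 1.
  by rewrite ger0_norm ?divr_ge0 ?normc_ge0 ?ltW // ltr_pdivrMr // mul1r.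
have bnd n : normc (c n * z ^+ n) <= geometric B q n.
  rewrite normCM normcX /geometric /= /q expr_div_n mulrA ler_pdivlMr ?exprn_gt0 //.
  by rewrite mulrAC ler_wpM2r ?exprn_ge0 ?normc_ge0.
have cg : cvgn (series (geometric B q)) by apply: is_cvg_geometric_series.
have B0 := weight_bounded_ge0 wb.
have gg n : 0 <= geometric B q n.
  by rewrite /geometric /= mulr_ge0 ?exprn_ge0 // divr_ge0 ?normc_ge0 ?ltW.
have cR : cvgn (series (fun n => complex.Re (c n * z ^+ n))).
  apply: normed_cvg; apply: series_le_cvg cg => //= n.
  by apply: le_trans (bnd n); apply: normc_gtRe.
have cI : cvgn (series (fun n => complex.Im (c n * z ^+ n))).
  apply: normed_cvg; apply: series_le_cvg cg => //= n.
  by apply: le_trans (bnd n); apply: normc_gtIm.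
have -> : series (fun n => c n * z ^+ n) = fun n =>
   Complex (series (fun n => complex.Re (c n * z ^+ n)) n)
       (series (fun n => complex.Im (c n * z ^+ n)) n).
  apply/funext; elim=> [|n IH]; first by rewrite /series /= !big_geq.
  by rewrite !seriesSr IH; case: (c n * z ^+ n) => a b /=.
apply/cvg_ex; eexists; apply: cvg_complex; [exact: cR|exact: cI].
Qed.

Lemma psum_bound rho B c z : weight_bounded rho B c -> normc z < rho ->
  normc (power_series_sum c z) <= B * rho / (rho - normc z).
Proof.
move=> wb zr; have cv := psum_cvg wb zr.
have B0 := weight_bounded_ge0 wb.
have r0 : 0 < rho by apply: le_lt_trans zr; apply: normc_ge0.
have d0 : 0 < rho - normc z by rewrite subr_gt0.
apply: cvg_normc_le cv _ => n.
apply: le_trans (normc_sum _ _ _) _.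
set q := normc z / rho.
have q0 : 0 <= q by rewrite divr_ge0 ?normc_ge0 ?ltW.
have q1 : q < 1 by rewrite ltr_pdivrMr // mul1r.
have -> : B * rho / (rho - normc z) = B / (1 - q).
  by rewrite /q; field; rewrite !gt_eqF.
apply: (@le_trans _ _ (B * \sum_(0 <= i < n) q ^+ i)).
  rewrite mulr_sumr; apply: ler_sum => i _.
  rewrite normCM normcX /= /q expr_div_n mulrA ler_pdivlMr ?exprn_gt0 //.
  by rewrite mulrAC ler_wpM2r ?exprn_ge0 ?normc_ge0.
rewrite ler_wpM2l // -[leRHS]mul1r ler_pdivlMr ?subr_gt0 // mulrC.
rewrite big_mkord -opprB mulNr -subrX1 opprB gerBl.
by rewrite exprn_ge0.
Qed.

Lemma psum_eq c c' z : c =1 c' -> power_series_sum c z = power_series_sum c' z.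
Proof. by move=> /funext ->. Qed.

Lemma psumD rho B B' c d z : weight_bounded rho B c -> weight_bounded rho B' d ->
  normc z < rho ->
  power_series_sum (fun n => c n + d n) z = power_series_sum c z + power_series_sum d z.
Proof.
move=> wc wd zr; rewrite /power_series_sum -lim_seriesD; try exact: psum_cvg zr.
by congr (limn (series _)); apply/funext => n /=; rewrite mulrDl.
Qed.

Lemma psumZ rho B c l z : weight_bounded rho B c -> normc z < rho ->
  power_series_sum (fun n => l * c n) z = l * power_series_sum c z.
Proof.
move=> wc zr; rewrite /power_series_sum.
rewrite -[RHS]/(l *: (limn (series (fun n => c n * z ^+ n)) : R[i]^o)) -lim_seriesZ; last exact: psum_cvg zr.
by congr (limn (series _)); apply/funext => n /=; rewrite -mulrA.
Qed.

Lemma psum_shift rho B B' c z : weight_bounded rho B c -> weight_bounded rho B' (shift c) ->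
  normc z < rho ->
  power_series_sum c z = c 0%N + z * power_series_sum (shift c) z.
Proof.
move=> wc ws zr.
apply/cvg_lim => //; rewrite -cvg_shiftS.
have -> : [sequence series (fun n => c n * z ^+ n) n.+1]_n =
  (fun n => c 0%N + z * series (fun n => shift c n * z ^+ n) n).
  apply/funext => n; rewrite /series /= big_nat_recl //= expr0 mulr1; congr (_ + _).
  by rewrite mulr_sumr; apply: eq_bigr => i _; rewrite /shift exprS mulrCA.
by apply: cvgD; [exact: cvg_cst|apply: cvgM; [exact: cvg_cst|exact: psum_cvg zr]].
Qed.

Lemma weight_boundedD rho B B' c d : 0 < rho -> weight_bounded rho B c ->
  weight_bounded rho B' d -> weight_bounded rho (B + B') (fun n => c n + d n).
Proof.
move=> r0 wc wd n; apply: le_trans (lerD (wc n) (wd n)).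
by rewrite /= -mulrDl ler_wpM2r ?ler_normcD // exprn_ge0 // ltW.
Qed.

Lemma weight_boundedZ rho B c l : weight_bounded rho B c ->
  weight_bounded rho (normc l * B) (fun n => l * c n).
Proof. by move=> wc n; rewrite normCM -mulrA ler_wpM2l ?normc_ge0. Qed.

Lemma weight_bounded_shift rho B c k : 0 < rho -> weight_bounded rho B c ->
  weight_bounded rho (B / rho ^+ k) (fun j => c (k + j)%N).
Proof.
move=> r0 wc n; rewrite ler_pdivlMr ?exprn_gt0 // -mulrA -exprD (addnC n k).
exact: wc.
Qed.

(** Division by z - l keeps the weight [rho]: iterated quotients stay in one
    weighted space. *)
Lemma weight_bounded_quot rho B c l : weight_bounded rho B c -> normc l < rho ->
  weight_bounded rho (B / (rho - normc l)) (quot c l).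
Proof.
move=> wc lr n; have r0 : 0 < rho by apply: le_lt_trans lr; apply: normc_ge0.
have d0 : 0 < rho - normc l by rewrite subr_gt0.
apply: (@le_trans _ _ ((B / rho ^+ n.+1) * rho / (rho - normc l) * rho ^+ n)).
  rewrite ler_wpM2r ?exprn_ge0 ?(ltW r0) //.
  exact: (psum_bound (weight_bounded_shift n.+1 r0 wc) lr).
rewrite le_eqVlt; apply/orP; left; apply/eqP; rewrite exprS; field.
by rewrite !gt_eqF ?exprn_gt0.
Qed.

Lemma quot_rec rho B c l k : weight_bounded rho B c -> normc l < rho ->
  quot c l k = c k.+1 + l * quot c l k.+1.
Proof.
move=> wc lr; have r0 : 0 < rho by apply: le_lt_trans lr; apply: normc_ge0.
rewrite /quot (psum_shift (weight_bounded_shift k.+1 r0 wc) _ lr (B' := B / rho ^+ k.+2)).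
  rewrite addn0; congr (_ + _ * _); apply: psum_eq => j.
  by rewrite /shift addnS.
move=> n; rewrite /shift addnS.
exact: (weight_bounded_shift k.+2 r0 wc n).
Qed.

Fact quot_psum_algebra (K : comPzRingType) (a b e l z : K) :
  a + z * (b + z * e - l * e) = a + l * b + (z - l) * (b + z * e).
Proof. ring. Qed.

Lemma quot_psum rho B c l z : weight_bounded rho B c -> normc l < rho -> normc z < rho ->
  power_series_sum c z = power_series_sum c l + (z - l) * power_series_sum (quot c l) z.
Proof.
move=> wc lr zr; have r0 : 0 < rho by apply: le_lt_trans lr; apply: normc_ge0.
have ws : weight_bounded rho (B / rho ^+ 1) (shift c) by apply: weight_bounded_shift.
have wq := weight_bounded_quot wc lr.
have wqs : weight_bounded rho (B / (rho - normc l) / rho ^+ 1) (shift (quot c l)).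
  by apply: weight_bounded_shift.
rewrite (psum_shift wc ws zr) (psum_shift wc ws lr).
have -> : power_series_sum (shift c) l = quot c l 0 by [].
have -> : power_series_sum (shift c) z =
    power_series_sum (quot c l) z - l * power_series_sum (shift (quot c l)) z.
  rewrite -mulNr -(psumZ (- l) wqs zr) -(psumD wq (weight_boundedZ _ wqs) zr).
  by apply: psum_eq => n; rewrite (quot_rec n wc lr) /shift; ring.
rewrite (psum_shift wq wqs zr).
exact: quot_psum_algebra.
Qed.

Lemma quot_shift c l k : quot (fun n => c (k + n)%N) l = fun n => quot c l (k + n)%N.
Proof.
by apply/funext => n; apply: psum_eq => j; rewrite -addnS addnA.
Qed.

(** The resolvent identity for the division operators; it gives their
    Lipschitz dependence on the point of division. *)
Lemma quotB rho B c l m k : weight_bounded rho B c -> normc l < rho -> normc m < rho ->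
  quot c l k - quot c m k = (l - m) * quot (quot c m) l k.
Proof.
move=> wc lr mr; have r0 : 0 < rho by apply: le_lt_trans lr; apply: normc_ge0.
have := quot_psum (weight_bounded_shift k.+1 r0 wc) mr lr.
rewrite quot_shift -/(quot c l k) -/(quot c m k) => ->.
by rewrite addrAC subrr add0r.
Qed.

(** Joint continuity of the value f(l) in the coefficients and in l. *)
Lemma psum_close s rho B B' c d l m : s < rho -> normc l <= s -> normc m <= s ->
  weight_bounded rho B c -> weight_bounded rho B' (fun n => d n - c n) ->
  normc (power_series_sum d m - power_series_sum c l) <=
    normc (m - l) * (B * rho / (rho - s) ^+ 2) + B' * rho / (rho - s).
Proof.
move=> sr ls ms wc wdc.
have lr := le_lt_trans ls sr; have mr := le_lt_trans ms sr.
have r0 : 0 < rho by apply: le_lt_trans lr; apply: normc_ge0.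
have B0 := weight_bounded_ge0 wc; have B'0 := weight_bounded_ge0 wdc.
have s0 : 0 < rho - s by rewrite subr_gt0.
have -> : power_series_sum d m =
   power_series_sum c m + power_series_sum (fun n => d n - c n) m.
  rewrite -(psumD wc wdc mr); apply: psum_eq => n; ring.
rewrite (quot_psum wc lr mr) addrAC [_ + (m - l) * _]addrC addrK.
apply: le_trans (ler_normcD _ _) _; apply: lerD.
  rewrite normCM ler_wpM2l ?normc_ge0 //.
  apply: le_trans (psum_bound (weight_bounded_quot wc lr) mr) _.
  have h1 : (rho - normc l)^-1 <= (rho - s)^-1.
    by rewrite lef_pV2 ?posrE ?subr_gt0 // lerD2l lerN2.
  have h2 : (rho - normc m)^-1 <= (rho - s)^-1.
    by rewrite lef_pV2 ?posrE ?subr_gt0 // lerD2l lerN2.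
  rewrite (mulrAC B) -!mulrA ler_wpM2l // expr2 invfM ler_wpM2l ?(ltW r0) //.
  by apply: ler_pM => //; rewrite invr_ge0 subr_ge0 ltW.
apply: le_trans (psum_bound wdc mr) _.
rewrite ler_wpM2l ?mulr_ge0 ?(ltW r0) // lef_pV2 ?posrE ?subr_gt0 //.
by rewrite lerD2l lerN2.
Qed.

(** Joint continuity of the quotient, in the same weighted norm. *)
Lemma quot_close s rho B B' c d l m : s < rho -> normc l <= s -> normc m <= s ->
  weight_bounded rho B c -> weight_bounded rho B' (fun n => d n - c n) ->
  weight_bounded rho (normc (m - l) * (B / (rho - s) ^+ 2) + B' / (rho - s))
    (fun n => quot d m n - quot c l n).
Proof.
move=> sr ls ms wc wdc.
have lr := le_lt_trans ls sr; have mr := le_lt_trans ms sr.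
have r0 : 0 < rho by apply: le_lt_trans lr; apply: normc_ge0.
have B0 := weight_bounded_ge0 wc; have B'0 := weight_bounded_ge0 wdc.
have s0 : 0 < rho - s by rewrite subr_gt0.
have h1 : (rho - normc l)^-1 <= (rho - s)^-1.
  by rewrite lef_pV2 ?posrE ?subr_gt0 // lerD2l lerN2.
have h2 : (rho - normc m)^-1 <= (rho - s)^-1.
  by rewrite lef_pV2 ?posrE ?subr_gt0 // lerD2l lerN2.
have -> : (fun n => quot d m n - quot c l n) =
  (fun n => (m - l) * quot (quot c l) m n + quot (fun n => d n - c n) m n).
  apply/funext => n; rewrite -(quotB _ wc mr lr).
  have -> : quot d m n = quot c m n + quot (fun n => d n - c n) m n.
    rewrite -(psumD (weight_bounded_shift n.+1 r0 wc) (weight_bounded_shift n.+1 r0 wdc) mr).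
    by apply: psum_eq => j /=; ring.
  by rewrite addrAC.
move=> n; apply: le_trans (weight_boundedD r0 (weight_boundedZ _
  (weight_bounded_quot (weight_bounded_quot wc lr) mr)) (weight_bounded_quot wdc mr) n) _.
apply: lerD; last by rewrite ler_wpM2l.
rewrite ler_wpM2l ?normc_ge0 // -mulrA ler_wpM2l // expr2 invfM.
by apply: ler_pM => //; rewrite invr_ge0 subr_ge0 ltW.
Qed.

End power_series.

(** * Approximate zeros: closedness and stability *)

Section approximate_zeros.
Context (R : realType).
Local Notation C := (Num.NumField.sort (complex_complex__canonical__Num_NumField R)).
Implicit Types (z l m : C) (c d : nat -> C) (rho s B e : R).

(** Bolzano and Weierstrass in the plane. *)
Lemma bounded_cluster_point (u : nat -> C) s : (forall n, normc (u n) <= s) ->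
  exists2 l : C, normc l <= s &
    forall e, 0 < e -> forall n0, exists2 n, (n0 <= n)%N & normc (u n - l) < e.
Proof.
move=> us.
pose v n : R * R := (complex.Re (u n), complex.Im (u n)).
have cK : compact (`[- s, s]%classic `*` `[- s, s]%classic : set (R * R)).
  by apply: compact_setX; apply: segment_compact.
have FK : (v n @[n --> \oo]) (`[- s, s]%classic `*` `[- s, s]%classic).
  exists 0%N => // n _ /=; rewrite !in_itv /= -!ler_norml.
  by split; apply: le_trans (us n); [exact: normc_gtRe|exact: normc_gtIm].
have [[x y] [_ cl]] := cK _ _ FK.
have H : forall e, 0 < e -> forall n0, exists2 n, (n0 <= n)%N & normc (u n - (Complex x y : C)) < e.
  move=> e e0 n0.
  have e2 : 0 < e / 2 by lra.
  have A : (v n @[n --> \oo]) [set v n | n in [set n | (n0 <= n)%N]].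
    by exists n0 => // n nn; exists n.
  have Bn : nbhs (x, y) (ball x (e / 2) `*` ball y (e / 2)).
    by exists (ball x (e / 2), ball y (e / 2)) => //=; split; exact: nbhsx_ballx.
  have [_ [[n nn <-]]] := cl _ _ A Bn.
  rewrite /ball /= => -[h1 h2]; exists n => //.
  have h := normc_leD (u n - (Complex x y : C)).
  apply: le_lt_trans h _.
  move: h1 h2; rewrite distrC (distrC y) => h1 h2.
  have -> : complex.Re (u n - (Complex x y : C)) = complex.Re (u n) - x by case: (u n).
  have -> : complex.Im (u n - (Complex x y : C)) = complex.Im (u n) - y by case: (u n).
  lra.
exists (Complex x y) => //; rewrite leNgt; apply/negP => h.
have [n _ h2] := H (normc (Complex x y : C) - s) (etrans (subr_gt0 _ _) h) 0%N.
have := ler_normcD ((Complex x y : C) - u n) (u n); rewrite subrK => h3.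
have := us n; move: h2; rewrite normcB; lra.
Qed.

Lemma weight_bounded_le rho B B' c : weight_bounded rho B c -> B <= B' ->
  weight_bounded rho B' c.
Proof. by move=> wc BB n; apply: le_trans BB. Qed.

(** Zeros are divided out one after the other, so that repeated points stand
    for multiple zeros; [e = 0] gives genuine zeros. *)
Fixpoint approx_zeros k s e c : Prop :=
  if k is k'.+1 then
    exists l, [/\ normc l <= s, normc (power_series_sum c l) <= e
                & approx_zeros k' s e (quot c l)]
  else True.

Lemma approx_zeros_le k s s' e e' c : s <= s' -> e <= e' -> approx_zeros k s e c ->
  approx_zeros k s' e' c.
Proof.
move=> ss ee; elim: k c => //= k IH c [l [ls le az]]; exists l; split; last exact: IH.
- exact: le_trans ss.
- exact: le_trans ee.
Qed.

(** By induction on [k]: the first approximate zeros of the approximating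
    series accumulate at a zero [l], and along this accumulation the quotients
    approximate [quot c l]. *)
Lemma approx_zeros_closed k s rho B c : s < rho -> weight_bounded rho B c ->
  (forall e, 0 < e -> exists2 d, weight_bounded rho e (fun n => d n - c n)
                               & approx_zeros k s e d) ->
  approx_zeros k s 0 c.
Proof.
move=> sr; elim: k B c => //= k IH B c wc H.
have B0 := weight_bounded_ge0 wc.
have /choice [f Hf] : forall n : nat, exists p : (nat -> C) * C,
    weight_bounded rho (n.+1%:R^-1) (fun n => p.1 n - c n) /\
    [/\ normc p.2 <= s, normc (power_series_sum p.1 p.2) <= n.+1%:R^-1
      & approx_zeros k s (n.+1%:R^-1) (quot p.1 p.2)].
  move=> n; have [|d wd [l hl]] := H (n.+1%:R^-1); first by rewrite invr_gt0 ltr0n.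
  by exists (d, l).
have fs n : normc (f n).2 <= s by have [_ []] := Hf n.
have [l ls Hl] := @bounded_cluster_point (fun n => (f n).2) s fs.
have near_l : forall e, 0 < e -> exists2 n, normc ((f n).2 - l) <= e & n.+1%:R^-1 <= e.
  move=> e e0; have [n nn h] := Hl e e0 (Num.truncn e^-1).
  exists n; first exact: ltW.
  rewrite -[leRHS]invrK lef_pV2 ?posrE ?invr_gt0 ?ltr0n //.
  have := truncnS_gt (e^-1); move=> h2; apply/ltW/(lt_le_trans h2).
  by rewrite ler_nat.
have s0 : 0 <= s by apply: le_trans ls; apply: normc_ge0.
have r0 : 0 < rho by apply: le_lt_trans sr.
have d0 : 0 < rho - s by rewrite subr_gt0.
exists l; split => //.
  rewrite leNgt; apply/negP => x0.
  set x := normc _ in x0.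
  set K1 := B * rho / (rho - s) ^+ 2; set K2 := rho / (rho - s).
  have K10 : 0 <= K1 by rewrite divr_ge0 ?mulr_ge0 ?exprn_ge0 // ltW.
  have K20 : 0 <= K2 by rewrite divr_ge0 // ltW.
  have KK : 0 < 2 * (K1 + K2 + 1) by lra.
  have [n h1 h2] := near_l _ (divr_gt0 x0 KK).
  have [wd [ds dz _]] := Hf n.
  move: (n.+1%:R^-1) h2 wd dz => t h2 wd dz.
  have := psum_close sr ls ds wc wd; rewrite -/K1 -mulrA -/K2 => h3.
  have := ler_normcD (power_series_sum c l - power_series_sum (f n).1 (f n).2) (power_series_sum (f n).1 (f n).2).
  rewrite subrK normcB -/x => h4.
  set eta := x / _ in h1 h2.
  have ex : eta * (K1 + K2 + 1) = x / 2 by rewrite /eta; field; lra.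
  have h5 : normc ((f n).2 - l) * K1 <= eta * K1 by rewrite ler_wpM2r.
  have h6 : t * K2 <= eta * K2 by rewrite ler_wpM2r.
  lra.
have wq := weight_bounded_quot wc (le_lt_trans ls sr).
apply: (IH _ _ wq) => e e0.
set K1 := B / (rho - s) ^+ 2; set K2 := (rho - s)^-1.
have K10 : 0 <= K1 by rewrite divr_ge0 ?exprn_ge0 // ltW.
have K20 : 0 <= K2 by rewrite invr_ge0 // ltW.
have KK : 0 < K1 + K2 + 1 by lra.
have [n h1 h2] := near_l _ (divr_gt0 e0 KK).
have [wd [ds dz az]] := Hf n.
move: (n.+1%:R^-1) h2 wd dz az => t h2 wd dz az.
set eta := e / _ in h1 h2.
have ex : eta * (K1 + K2 + 1) = e by rewrite /eta; field; lra.
have eta0 : 0 < eta by rewrite divr_gt0.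
have h5 : normc ((f n).2 - l) * K1 <= eta * K1 by rewrite ler_wpM2r.
have h6 : t * K2 <= eta * K2 by rewrite ler_wpM2r.
have ee : eta <= e.
  by rewrite /eta ler_pdivrMr // ler_peMr ?(ltW e0) // -subr_ge0 addrK addr_ge0.
exists (quot (f n).1 (f n).2); last exact: approx_zeros_le (le_trans h2 ee) az.
apply: weight_bounded_le (quot_close sr ls ds wc wd) _.
rewrite -/K1 -/K2; lra.
Qed.

Definition rat_complex (q : rat * rat) : C := Complex (ratr q.1) (ratr q.2).

Fixpoint rational_zeros k s e c : Prop :=
  if k is k'.+1 then
    exists q, [/\ normc (rat_complex q) <= s,
                  normc (power_series_sum c (rat_complex q)) <= e
                & rational_zeros k' s e (quot c (rat_complex q))]
  else True.

Lemma rational_approx_zeros k s e c : rational_zeros k s e c -> approx_zeros k s e c.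
Proof.
by elim: k c => //= k IH c [q [h1 h2 h3]]; exists (rat_complex q); split => //; apply: IH.
Qed.

Lemma rat_complex_dense l e : 0 < e -> exists q, normc (rat_complex q - l) < e.
Proof.
move=> e0; case: l => x y; have e2 : 0 < e / 2 by lra.
have [q /andP[q1 q2]] : exists q : rat, x < ratr q < x + e / 2.
  have [|q] := @rat_in_itvoo R x (x + e / 2); first by lra.
  by rewrite in_itv /=; exists q.
have [p /andP[p1 p2]] : exists q : rat, y < ratr q < y + e / 2.
  have [|p] := @rat_in_itvoo R y (y + e / 2); first by lra.
  by rewrite in_itv /=; exists p.
exists (q, p); apply: le_lt_trans (normc_leD _) _.
by rewrite /= !gtr0_norm; lra.
Qed.

(** Conversely genuine zeros survive, as approximate zeros at nearby rational
    points, under small changes of the coefficients. *)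
Lemma approx_zeros_perturb k s s' rho B e c : s < s' -> s' < rho -> 0 < e ->
  weight_bounded rho B c -> approx_zeros k s 0 c ->
  exists2 eta, 0 < eta & forall d, weight_bounded rho eta (fun n => d n - c n) ->
    rational_zeros k s' e d.
Proof.
move=> ss sr e0; elim: k B c => [|k IH] B c wc; first by exists 1.
move=> /= [l [ls lz az]].
have B0 := weight_bounded_ge0 wc.
have s0 : 0 <= s by apply: le_trans ls; apply: normc_ge0.
have lr : normc l < rho by apply: le_lt_trans ls _; exact: lt_trans sr.
have r0 : 0 < rho by apply: le_lt_trans lr; apply: normc_ge0.
have d0 : 0 < rho - s' by rewrite subr_gt0.
have [eta1 eta10 Heta1] := IH _ _ (weight_bounded_quot wc lr) az.
set K1 := B * rho / (rho - s') ^+ 2; set K2 := rho / (rho - s').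
set K3 := B / (rho - s') ^+ 2; set K4 := (rho - s')^-1.
have K10 : 0 <= K1 by rewrite divr_ge0 ?mulr_ge0 ?exprn_ge0 // ltW.
have K20 : 0 <= K2 by rewrite divr_ge0 // ltW.
have K30 : 0 <= K3 by rewrite divr_ge0 ?exprn_ge0 // ltW.
have K40 : 0 <= K4 by rewrite invr_ge0 // ltW.
pose eta := Num.min (s' - s) (Num.min (e / (K1 + K2 + 1)) (eta1 / (K3 + K4 + 1))).
have eta0 : 0 < eta.
  by rewrite !lt_min subr_gt0 ss !divr_gt0 //; lra.
have ha : eta <= s' - s by rewrite ge_min lexx.
have hb : eta * (K1 + K2 + 1) <= e.
  by rewrite -ler_pdivlMr; [rewrite !ge_min lexx orbT|lra].
have hc : eta * (K3 + K4 + 1) <= eta1.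
  by rewrite -ler_pdivlMr; [rewrite !ge_min lexx !orbT|lra].
have [q hq] := rat_complex_dense l eta0.
have qs : normc (rat_complex q) <= s'.
  have := ler_normcD (rat_complex q - l) l; rewrite subrK; lra.
exists eta => // d wd.
have ls' : normc l <= s' by lra.
have h5 : normc (rat_complex q - l) * K1 <= eta * K1 by rewrite ler_wpM2r // ltW.
have h6 : normc (rat_complex q - l) * K3 <= eta * K3 by rewrite ler_wpM2r // ltW.
exists q; split; first exact: qs.
  have := psum_close sr ls' qs wc wd; rewrite -/K1 -mulrA -/K2 => h3.
  have := ler_normcD (power_series_sum d (rat_complex q) - power_series_sum c l) (power_series_sum c l).
  rewrite subrK => h4; apply: le_trans h4 _; apply: le_trans (lerD h3 lz) _.
  by move: (_ * K1) h5 => t h5; lra.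
apply: Heta1; apply: weight_bounded_le (quot_close sr ls' qs wc wd) _.
by rewrite -/K3 -/K4; move: (_ * K3) h6 => t h6; lra.
Qed.

End approximate_zeros.

(** * Derivatives of power series and of their quotients *)

Section coefficient_algebra.
Context (K : comPzRingType).
Implicit Types (c g : nat -> K) (l : K).

Definition deriv_coef c : nat -> K := fun n => c n.+1 *+ n.+1.

Definition mulX c : nat -> K := fun n => if n is n'.+1 then c n' else 0.

(** Partial sums of the derivative at [l] against partial sums of the quotient
    at [l]; this avoids exchanging two summations. *)
Lemma sum_deriv_telescope c g l n : (forall k, c k.+1 = g k - l * g k.+1) ->
  \sum_(0 <= k < n) deriv_coef c k * l ^+ k =
  \sum_(0 <= k < n) g k * l ^+ k - g n *+ n * l ^+ n.
Proof.
move=> cE; elim: n => [|n IH]; first by rewrite !big_geq // mulr0n mul0r subr0.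
rewrite !big_nat_recr //= IH /deriv_coef cE exprS.
rewrite -(mulr_natr (g n) n) -(mulr_natr (g n.+1) n.+1) -(mulr_natr (_ - _) n.+1) -natr1.
by ring.
Qed.

(** The Leibniz rule for (z - l) g(z), at the level of coefficients. *)
Lemma iter_deriv_factor c g l j : (forall n, c n = mulX g n - l * g n) ->
  forall n, iter j deriv_coef c n = mulX (iter j deriv_coef g) n
    - l * iter j deriv_coef g n + iter j.-1 deriv_coef g n *+ j.
Proof.
move=> cE; elim: j => [|j IH] n; first by rewrite /= cE mulr0n addr0.
rewrite iterS {1}/deriv_coef IH; set G := iter j _ _.
have GS : iter j.+1 deriv_coef g = deriv_coef G by [].
have HG : iter j.-1 deriv_coef g n.+1 *+ j *+ n.+1 = G n *+ j.
  by rewrite /G; case: (j) => [|i]; rewrite ?mulr0n ?mul0rn // -mulrnA mulnC mulrnA.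
rewrite mulrnDl HG GS /= -/G {HG GS IH}.
have -> : mulX (deriv_coef G) n = G n *+ n by case: n.
rewrite /deriv_coef; move: (G n) (G n.+1) => a b.
rewrite -(mulr_natr a n) -(mulr_natr a j) -(mulr_natr a j.+1).
rewrite -(mulr_natr b n.+1) -(mulr_natr (_ - _) n.+1) -!natr1.
by ring.
Qed.

End coefficient_algebra.
Arguments deriv_coef {K} c n : simpl never.
Arguments mulX {K} c n.

Section zero_counting.
Context (R : realType).
Local Notation C := (Num.NumField.sort (complex_complex__canonical__Num_NumField R)).
Implicit Types (z l m : C) (c d g : nat -> C) (rho s B e r : R).

(** The radius of convergence is at least [r]. *)
Definition converges_in_disk r c :=
  forall rho, 0 < rho -> rho < r -> exists B, weight_bounded rho B c.

Lemma normCMn z n : normc (z *+ n) = normc z *+ n.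
Proof.
elim: n => [|n IH]; first by rewrite !mulr0n normc0.
by rewrite -mulr_natr normCM -[in RHS]mulr_natr -(normr_nat R n.+1) -normc_real rmorph_nat.
Qed.

Lemma natmul_exp_le (q : R) n : 0 <= q -> q < 1 -> q ^+ n *+ n <= (1 - q)^-1.
Proof.
move=> q0 q1; have p0 : 0 < 1 - q by rewrite subr_gt0.
elim: n => [|n IH]; first by rewrite mulr0n invr_ge0 ltW.
have key k : q ^+ k *+ k <= \sum_(i < k) q ^+ i.
  rewrite -[X in _ *+ X]card_ord -sumr_const; apply: ler_sum => i _.
  by apply: ler_wiXn2l => //; [exact: ltW|exact: ltnW].
apply: le_trans (key _) _.
rewrite -[leRHS]mul1r ler_pdivlMr // mulrC -opprB mulNr -subrX1 opprB gerBl.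
exact: exprn_ge0.
Qed.

Lemma weight_bounded_natmul rho rho' B c : 0 < rho -> rho < rho' ->
  weight_bounded rho' B c -> exists B', weight_bounded rho B' (fun n => c n *+ n).
Proof.
move=> r0 rr wc; have r'0 : 0 < rho' by apply: lt_trans rr.
have B0 := weight_bounded_ge0 wc.
exists (B * (1 - rho / rho')^-1) => n.
have q1 : rho / rho' < 1 by rewrite ltr_pdivrMr // mul1r.
have q0 : 0 <= rho / rho' by rewrite divr_ge0 ?ltW.
apply: le_trans (ler_wpM2l B0 (natmul_exp_le n q0 q1)).
rewrite normCMn mulrnAl mulrnAr lerMn2r; apply/orP; right.
rewrite expr_div_n mulrA ler_pdivlMr ?exprn_gt0 // mulrAC ler_wpM2r ?exprn_ge0 ?(ltW r0) //.
Qed.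

Lemma converges_deriv r c : converges_in_disk r c -> converges_in_disk r (deriv_coef c).
Proof.
move=> H rho r0 rr; pose rho' := (rho + r) / 2.
have [||B wB] := H rho'; try by rewrite /rho'; lra.
have [|B' wB'] := weight_bounded_natmul r0 _ wB; first by rewrite /rho'; lra.
exists (B' / rho) => n; rewrite ler_pdivlMr // -mulrA -exprSr; exact: wB'.
Qed.

Lemma converges_quot r c l : normc l < r -> converges_in_disk r c ->
  converges_in_disk r (quot c l).
Proof.
move=> lr H rho r0 rr; pose rho' := (Num.max rho (normc l) + r) / 2.
have [h1 h2] : Num.max rho (normc l) < rho' /\ rho' < r.
  by have : Num.max rho (normc l) < r; [rewrite gt_max rr|rewrite /rho'; lra].
move: h1; rewrite gt_max => /andP[h1 h3].
have [B wB] := H rho' (lt_trans r0 h1) h2.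
have wq := weight_bounded_quot wB h3.
exists (B / (rho' - normc l)) => n.
apply: le_trans (wq n); rewrite ler_wpM2l ?normc_ge0 //.
by rewrite lerXn2r ?nnegrE ?ltW // (lt_trans r0).
Qed.

Lemma converges_between r c s : 0 <= s -> s < r -> converges_in_disk r c ->
  exists rho B, [/\ s < rho, rho < r & weight_bounded rho B c].
Proof.
move=> s0 sr H; have [||B wB] := H ((s + r) / 2); try lra.
by exists ((s + r) / 2), B; split => //; lra.
Qed.

(** The difference quotient at [l] is the quotient series, so its value at [l]
    has to be the derivative. *)
Lemma psum_quot_deriv r c l : normc l < r -> converges_in_disk r c ->
  power_series_sum (quot c l) l = power_series_sum (deriv_coef c) l.
Proof.
move=> lr H.
have l0 := normc_ge0 l.
have [rho [B [h1 h2 wB]]] := converges_between l0 lr H.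
have r0 : 0 < rho by apply: le_lt_trans h1.
have [rho1 [h3 h4]] : exists rho1, normc l < rho1 /\ rho1 < rho.
  by exists ((normc l + rho) / 2); lra.
have [B1 wn] := weight_bounded_natmul (le_lt_trans l0 h3) h4 (weight_bounded_quot wB h1).
have [rho2 [B2 [h5 _ wd]]] := converges_between l0 lr (converges_deriv H).
have cvn := cvg_series_cvg_0 (psum_cvg wn h3 : cvgn (series ((fun n => quot c l n *+ n * l ^+ n : C^o)))).
rewrite [RHS]/power_series_sum; apply/esym/cvg_lim; first exact: norm_hausdorff.
have cE k : c k.+1 = quot c l k - l * quot c l k.+1 by rewrite (quot_rec k wB h1) addrK.
have -> : series (fun n => deriv_coef c n * l ^+ n) =
  fun n => series (fun n => quot c l n * l ^+ n) n - (quot c l n *+ n * l ^+ n).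
  by apply/funext => n; exact: sum_deriv_telescope cE.
rewrite -[X in _ --> X]subr0; apply: cvgB; last exact: cvn.
exact: psum_cvg (weight_bounded_quot wB h1) h1.
Qed.

Lemma dnbhs0_normc e : 0 < e -> \forall h \near (0 : C)^', normc h < e.
Proof.
move=> e0; have /cvg_normcP/(_ _ e0) : (h : C) @[h --> (0 : C)^'] --> (0 : C).
  exact: nbhs_dnbhs.
by apply: filterS => h; rewrite subr0.
Qed.

(** Stated for a function that agrees with the series only inside the disk of
    convergence, which is what the induction over higher derivatives needs. *)
Lemma derive1_psum r c l (F : C -> C) : converges_in_disk r c -> normc l < r ->
  (forall z, normc z < r -> F z = power_series_sum c z) ->
  derive1 F l = power_series_sum (deriv_coef c) l.
Proof.
move=> H lr HF; rewrite -(psum_quot_deriv lr H).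
have l0 := normc_ge0 l.
apply/cvg_lim => //; apply/cvg_normcP => e e0.
have [s [h0 h1]] : exists s, normc l < s /\ s < r by exists ((normc l + r) / 2); lra.
have [rho [B [h2 h3 wB]]] := converges_between (ltW (le_lt_trans l0 h0)) h1 H.
have wq := weight_bounded_quot wB (lt_trans h0 h2).
set K := B / (rho - normc l) * rho / (rho - s) ^+ 2.
have B0 := weight_bounded_ge0 wq.
have r0 : 0 < rho by lra.
have K0 : 0 <= K.
  by apply: divr_ge0; [apply: mulr_ge0; [exact: B0|exact: ltW]|apply: exprn_ge0; lra].
have d1 : 0 < s - normc l by lra.
have d2 : 0 < e / (K + 1) by rewrite divr_gt0 //; lra.
near=> h.
have hs : normc h < s - normc l by near: h; exact: dnbhs0_normc.
have he : normc h < e / (K + 1) by near: h; exact: dnbhs0_normc.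
have hn0 : h != 0 by near: h; exact: nbhs_dnbhs_neq.
have lhs : normc (h + l) <= s.
  by have := ler_normcD h l; lra.
have lhr : normc (h + l) < rho by apply: le_lt_trans lhs _.
rewrite HF ?(le_lt_trans lhs) // HF // (quot_psum wB (lt_trans h0 h2) lhr).
rewrite [_ + (h + l - l) * _]addrC addrK addrK.
rewrite -[h^-1 *: _]/(h^-1 * (h * power_series_sum (quot c l) (h + l))) mulKf //.
have w0 : weight_bounded rho 0 (fun n => quot c l n - quot c l n).
  by move=> n; rewrite subrr normc0 mul0r.
have := psum_close h2 (ltW h0) lhs wq w0.
rewrite !mul0r addr0 addrK -/K => h6; apply: le_lt_trans h6 _.
apply: (@le_lt_trans _ _ (normc h * (K + 1))); last by rewrite -ltr_pdivlMr //; lra.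
by rewrite ler_wpM2l ?normc_ge0 // lerDl.
Unshelve. all: by end_near. Qed.

Lemma converges_iter_deriv r c j : converges_in_disk r c ->
  converges_in_disk r (iter j deriv_coef c).
Proof. by move=> H; elim: j => //= j IH; exact: converges_deriv. Qed.

Lemma derive1n_psum r c j z : converges_in_disk r c -> normc z < r ->
  derive1n j (power_series_sum c) z = power_series_sum (iter j deriv_coef c) z.
Proof.
move=> H; elim: j z => //= j IH z zr.
exact: derive1_psum (converges_iter_deriv j H) zr IH.
Qed.

Lemma quot_factor r c l : converges_in_disk r c -> normc l < r ->
  power_series_sum c l = 0 -> forall n, c n = mulX (quot c l) n - l * quot c l n.
Proof.
move=> H lr c0.
have [rho [B [h2 h3 wB]]] := converges_between (normc_ge0 l) lr H.
have r0 : 0 < rho by apply: le_lt_trans h2; apply: normc_ge0.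
case=> [|n] /=; last by rewrite (quot_rec n wB h2) addrK.
apply/eqP; rewrite sub0r -addr_eq0; apply/eqP; rewrite -[RHS]c0.
by rewrite (psum_shift wB (weight_bounded_shift 1 r0 wB) h2).
Qed.

Lemma psum_iter_deriv_quot r c l j z : converges_in_disk r c -> normc l < r -> normc z < r ->
  power_series_sum c l = 0 ->
  power_series_sum (iter j deriv_coef c) z =
    (z - l) * power_series_sum (iter j deriv_coef (quot c l)) z +
    power_series_sum (iter j.-1 deriv_coef (quot c l)) z *+ j.
Proof.
move=> H lr zr c0.
have Hq := converges_quot lr H.
have z0 := normc_ge0 z.
have [rho0 [h0 h1]] : exists s, normc z < s /\ s < r by exists ((normc z + r) / 2); lra.
have r0 : 0 < rho0 by apply: le_lt_trans h0.
have [B w1] := converges_iter_deriv j Hq r0 h1.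
have [B' w2] := converges_iter_deriv j.-1 Hq r0 h1.
have cE := iter_deriv_factor j (quot_factor H lr c0).
move: (iter j _ (quot c l)) (iter j.-1 _ _) w1 w2 cE => G G' w1 w2 cE.
have wX : weight_bounded rho0 (B * rho0) (mulX G).
  move=> [|n]; first by rewrite normc0 mul0r mulr_ge0 ?(weight_bounded_ge0 w1) // ltW.
  by rewrite exprSr mulrA ler_wpM2r ?(ltW r0) //; exact: w1.
have -> : power_series_sum (iter j deriv_coef c) z =
    power_series_sum (fun n => mulX G n + ((- l) * G n + j%:R * G' n)) z.
  by apply: psum_eq => n; rewrite cE mulNr -addrA mulr_natl.
rewrite (psumD wX (weight_boundedD r0 (weight_boundedZ _ w1) (weight_boundedZ _ w2)) h0).
rewrite (psumD (weight_boundedZ _ w1) (weight_boundedZ _ w2) h0).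
rewrite (psumZ _ w1 h0) (psumZ _ w2 h0).
have wsX : weight_bounded rho0 B (shift (mulX G)) by move=> n; exact: w1.
rewrite (psum_shift wX wsX h0) add0r.
by rewrite addrA -mulrDl mulr_natl.
Qed.

End zero_counting.

(** * Counting zeros with multiplicity *)

Section vanishing_sets.
Context (K : numFieldType) (w : K) (P Q : nat -> K)
  (PQ : forall j, P j = w * Q j + Q j.-1 *+ j).

(** Away from the point of division, the vanishing order is unchanged. *)
Lemma vanishing_set_eq : w != 0 ->
  [set m | forall j, (j < m)%N -> P j = 0] = [set m | forall j, (j < m)%N -> Q j = 0].
Proof.
move=> w0; apply/seteqP; split => m /= Hm j jm.
  elim: j jm => [|j IH] jm; have /eqP := Hm _ jm; rewrite PQ.
    by rewrite mulr0n addr0 mulf_eq0 (negbTE w0) /= => /eqP.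
  by rewrite /= IH ?(ltnW jm) // mul0rn addr0 mulf_eq0 (negbTE w0) /= => /eqP.
by rewrite PQ (Hm j jm) mulr0 add0r Hm ?mul0rn // (leq_ltn_trans (leq_pred j)).
Qed.

(** At the point of division, the vanishing order goes up by one. *)
Lemma vanishing_setS : w = 0 ->
  [set m | forall j, (j < m)%N -> P j = 0] =
  [set m | if m is n.+1 then [set m | forall j, (j < m)%N -> Q j = 0] n else True].
Proof.
move=> w0; apply/seteqP; split => [[|m] //= Pm j jm|[|m] //= Qm [|j] jm].
- have := Pm j.+1 jm; rewrite PQ w0 mul0r add0r /= => /eqP.
  by rewrite mulrn_eq0 /= => /eqP.
- by rewrite PQ w0 mul0r mulr0n add0r.
- by rewrite PQ w0 mul0r add0r /= Qm // mul0rn.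
Qed.

End vanishing_sets.

Section counting.
Context (R : realType).
Local Notation C := (Num.NumField.sort (complex_complex__canonical__Num_NumField R)).
Implicit Types (z l m : C) (c d g : nat -> C) (rho s B e r : R).

Lemma vanishing_order_ge0 (f : C -> C) z : (0 <= vanishing_order R f z)%E.
Proof. by apply: ereal_sup_ubound; exists 0%N. Qed.

Lemma ereal_sup_natS (V W : set nat) : W = [set m | if m is n.+1 then V n else True] ->
  V 0%N ->
  ereal_sup [set (m%:R : R)%:E | m in W] = (ereal_sup [set (m%:R : R)%:E | m in V] + 1)%E.
Proof.
move=> -> V0; set S := ereal_sup [set _ | m in V].
have S0 : (0 <= S)%E by apply: ereal_sup_ubound; exists 0%N.
apply/eqP; rewrite eq_le; apply/andP; split.
  apply: ge_ereal_sup => _ [[|n] /= Vn <-]; first exact: adde_ge0.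
  by rewrite -natr1 EFinD leeD2r //; apply: ereal_sup_ubound; exists n.
rewrite -leeBrDr //; apply: ge_ereal_sup => _ [n Vn <-].
by rewrite leeBrDr // -EFinD natr1; apply: ereal_sup_ubound; exists n.+1.
Qed.

Lemma vanishing_order_quot r c l z : converges_in_disk r c -> normc l < r -> normc z < r ->
  power_series_sum c l = 0 ->
  vanishing_order R (power_series_sum c) z =
  (vanishing_order R (power_series_sum (quot c l)) z + (if z == l then 1 else 0))%E.
Proof.
move=> H lr zr c0.
have Hq := converges_quot lr H.
rewrite /vanishing_order.
set P := fun j => power_series_sum (iter j deriv_coef c) z.
set Q := fun j => power_series_sum (iter j deriv_coef (quot c l)) z.
have PQ j : P j = (z - l) * Q j + Q j.-1 *+ j by exact: (psum_iter_deriv_quot j H lr zr c0).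
set W := [set m | forall j, (j < m)%N -> derive1n j (power_series_sum c) z = 0].
set V := [set m | forall j, (j < m)%N -> derive1n j (power_series_sum (quot c l)) z = 0].
have VE : V = [set m | forall j, (j < m)%N -> Q j = 0].
  apply/seteqP; split => m Vm j jm; have := Vm j jm; rewrite (derive1n_psum j Hq zr) => h; exact: h.
have WE : W = [set m | forall j, (j < m)%N -> P j = 0].
  apply/seteqP; split => m Vm j jm; have := Vm j jm; rewrite (derive1n_psum j H zr) => h; exact: h.
rewrite VE WE; have [zl|zl] := eqVneq z l.
  apply: ereal_sup_natS; last by [].
  by apply: vanishing_setS PQ _; rewrite zl subrr.
by rewrite adde0 (vanishing_set_eq PQ) // subr_eq0.
Qed.

Lemma zero_count_quot r c l : converges_in_disk r c -> normc l < r ->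
  power_series_sum c l = 0 ->
  zero_count (power_series_sum c) r =
  (zero_count (power_series_sum (quot c l)) r + 1)%E.
Proof.
move=> H lr c0; rewrite /zero_count.
set D := [set z : R[i] | _].
have DE z : D z = (normc z < r) :> Prop by rewrite /D /= norm_normc ltcR.
transitivity (\esum_(z in D) (vanishing_order R (power_series_sum (quot c l)) z
   + (if z == l then 1 else 0)))%E.
  by apply: eq_esum => z; rewrite DE => zr; exact: (vanishing_order_quot H lr zr c0).
rewrite esumD; last 2 first.
- by move=> z _; exact: vanishing_order_ge0.
- by move=> z _; case: ifP.
congr (_ + _)%E.
have -> : \esum_(z in D) (if z == l then 1 else 0 : \bar R)%E =
   \esum_(z in D) (if z \in [set l] then 1 else 0 : \bar R)%E.
  apply: eq_esum => z _; congr (if _ then _ else _).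
  by apply/eqP/idP => [->|/set_mem]; [exact/mem_set|].
rewrite -esum_mkcondr setIidr ?esum_set1 // => _ ->; by rewrite DE.
Qed.

Lemma zero_count_ge0 (f : C -> C) r : (0 <= zero_count f r)%E.
Proof. by apply: esum_ge0 => z _; exact: vanishing_order_ge0. Qed.

(** The zero count is at least [x], hence at least [k], exactly when [k] zeros
    can be divided out. *)
Lemma zero_count_geP r c k (x : R) : converges_in_disk r c ->
  k%:R - 1 < x -> x <= k%:R ->
  (x%:E <= zero_count (power_series_sum c) r)%E <->
  exists2 s, s < r & approx_zeros k s 0 c.
Proof.
elim: k x c => [|k IH] x c H kx xk.
  split => _; first by exists (r - 1) => //; rewrite ltrBlDr ltrDl.
  by apply: le_trans (zero_count_ge0 _ _); rewrite lee_fin.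
have IHx l : normc l < r -> power_series_sum c l = 0 ->
    (x%:E <= zero_count (power_series_sum c) r)%E <->
    exists2 s, s < r & approx_zeros k s 0 (quot c l).
  move=> lr c0; rewrite (zero_count_quot H lr c0) -leeBlDr // -EFinB.
  apply: IH; first exact: converges_quot.
    by rewrite -natr1 in kx; lra.
  by rewrite -natr1 in xk; lra.
split => [xz|[s sr [l [ls c0 az]]]].
  have [[l [lr c0]]|nz] := pselect (exists l, normc l < r /\ power_series_sum c l = 0).
    have [s sr az] := (IHx l lr c0).1 xz.
    exists (Num.max s (normc l)); first by rewrite gt_max sr lr.
    exists l; split; first by rewrite le_max lexx orbT.
    - by rewrite c0 normc0.
    - by apply: approx_zeros_le az => //; rewrite le_max lexx.
  exfalso; move: xz; rewrite /zero_count esum1; last first.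
    move=> z; rewrite /= norm_normc ltcR => zr.
    apply/eqP; rewrite eq_le vanishing_order_ge0 andbT; apply: ge_ereal_sup => _ [[|m] Hm <-] //.
    by case: nz; exists z; split => //; exact: (Hm 0%N).
  by rewrite lee_fin => x0; have := ler0n R k; rewrite -natr1 in kx; lra.
have lr : normc l < r by apply: le_lt_trans ls sr.
have c0' : power_series_sum c l = 0.
  by apply: eq0_normc; apply/eqP; rewrite eq_le c0 normc_ge0.
by apply: (IHx l lr c0').2; exists s.
Qed.

Lemma cvg_psum_weight_bounded rho c z : 0 < rho -> rho <= normc z ->
  cvgn (series (fun n => c n * z ^+ n)) -> exists B, weight_bounded rho B c.
Proof.
move=> r0 rz /cvg_series_cvg_0/cvg_normcP/(_ _ ltr01) [n0 _ Hn].
exists (1 + \sum_(0 <= n < n0) normc (c n) * rho ^+ n) => n.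
have S0 k : 0 <= \sum_(0 <= n < k) normc (c n) * rho ^+ n.
  by apply: sumr_ge0 => i _; rewrite mulr_ge0 ?normc_ge0 ?exprn_ge0 ?(ltW r0).
have [nn|nn] := leqP n0 n.
  have := Hn n nn; rewrite /= subr0 normCM normcX => h.
  have : normc (c n) * rho ^+ n <= normc (c n) * normc z ^+ n.
    by rewrite ler_wpM2l ?normc_ge0 // lerXn2r ?nnegrE ?normc_ge0 ?(ltW r0).
  have := S0 n0; lra.
rewrite (big_cat_nat (n := n)) ?(ltnW nn) //= (big_ltn nn).
have := S0 n; have : 0 <= \sum_(n.+1 <= i < n0) normc (c i) * rho ^+ i.
  by apply: sumr_ge0 => i _; rewrite mulr_ge0 ?normc_ge0 ?exprn_ge0 ?(ltW r0).
lra.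
Qed.

Lemma derive1n_zero rho (F : C -> C) j z : (forall z, rho < normc z -> F z = 0) ->
  rho < normc z -> derive1n j F z = 0.
Proof.
move=> F0; elim: j z => [|j IH] z rz; first exact: F0.
rewrite -[LHS]/(derive1 (derive1n j F) z) /derive1; apply/cvg_lim; first exact: norm_hausdorff.
apply/cvg_normcP => e e0; have d0 : 0 < normc z - rho by rewrite subr_gt0.
near=> h.
have hd : normc h < normc z - rho by near: h; exact: dnbhs0_normc.
rewrite IH; last first.
  by have := ler_normcD (h + z) (- h); rewrite addrAC subrr add0r normCN; lra.
by rewrite (IH z rz) subrr scaler0 subr0 normc0.
Unshelve. all: by end_near. Qed.

(** Where the terms of the series are unbounded its sum is 0 by convention, so
    that every point of an annulus is a zero of infinite order. *)
Lemma zero_count_divergent r c : ~ converges_in_disk r c ->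
  zero_count (power_series_sum c) r = +oo%E.
Proof.
move=> nH.
have [rho [r0 rr nB]] : exists rho, [/\ 0 < rho, rho < r & forall B, ~ weight_bounded rho B c].
  apply: contrapT => K; apply: nH => rho r0 rr; apply: contrapT => nB; apply: K.
  by exists rho; split => // B wB; apply: nB; exists B.
have F0 z : rho < normc z -> power_series_sum c z = 0.
  move=> rz; apply: dvgP => cv.
  by have [B] := cvg_psum_weight_bounded r0 (ltW rz) cv; exact: nB.
pose z : C := ((rho + r) / 2)%:C%C.
have nz : normc z = (rho + r) / 2 by rewrite normc_real ger0_norm //; lra.
have Dz : [set z : R[i] | `|z| < r%:C%C] z by rewrite /= norm_normc ltcR nz; lra.
apply/eqP; rewrite -leye_eq; apply: esum_ge; exists [set z].
  by split => //; move=> _ ->.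
have ub n : (n%:R%:E <= vanishing_order R (power_series_sum c) z)%E.
  by apply: ereal_sup_ubound; exists n => // j _; apply: (derive1n_zero j F0); rewrite nz; lra.
rewrite fsbig_set1; move: (vanishing_order _ _ _) ub => [x| |] //= ub.
  have := ub (Num.truncn x).+1; rewrite lee_fin => /(lt_le_trans (truncnS_gt x)).
  by rewrite ltxx.
by have := ub 0%N.
Qed.

End counting.

(** * A dominant coefficient forces zeros *)

Lemma le_geometric_le0 (R : realType) (x t B : R) : 0 <= t -> t < 1 ->
  (forall j, x <= t ^+ j * B) -> x <= 0.
Proof.
move=> t0 t1 H; rewrite leNgt; apply/negP => x0.
have B0 : 0 <= B by have := H 0%N; rewrite expr0 mul1r; apply: le_trans; exact: ltW.
have K n : n%:R <= (1 - t)^-1 * B / x.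
  rewrite ler_pdivlMr // mulr_natl; apply: le_trans (ler_wMn2r n (H n)) _.
  by rewrite -mulrnAl ler_wpM2r // natmul_exp_le.
have := K (Num.truncn ((1 - t)^-1 * B / x)).+1.
by move/(lt_le_trans (truncnS_gt _)); rewrite ltxx.
Qed.

Section dominant_coefficient.
Context (R : realType) (K : closedFieldType) (N : K -> R).
Context (N_ge0 : forall x, 0 <= N x) (N_eq0 : forall x, N x = 0 -> x = 0)
  (N0 : N 0 = 0) (NM : forall x y, N (x * y) = N x * N y)
  (NN : forall x, N (- x) = N x) (ND : forall x y, N (x + y) <= N x + N y).
Context (rho : R) (rho_gt0 : 0 < rho).
Implicit Types (u v : nat -> K) (p q : {poly K}).

Lemma abs_sum (I : Type) (s : seq I) (P : pred I) (F : I -> K) :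
  N (\sum_(i <- s | P i) F i) <= \sum_(i <- s | P i) N (F i).
Proof.
elim/big_ind2: _ => [|x1 x2 y1 y2 h1 h2|//]; first by rewrite N0.
by apply: le_trans (ND _ _) _; apply: lerD.
Qed.

(** The power series of v / (X - z). *)
Fixpoint linear_quot z v n : K :=
  (if n is n'.+1 then linear_quot z v n' - v n else - v n) / z.

Lemma linear_quot_bounded z v B : rho < N z -> (forall n, N (v n) * rho ^+ n <= B) ->
  exists B', forall n, N (linear_quot z v n) * rho ^+ n <= B'.
Proof.
move=> rz vB; exists (B / (N z - rho)) => n.
have Nz0 : 0 < N z by apply: lt_trans rz.
have d0 : 0 < N z - rho by rewrite subr_gt0.
have z0 : z != 0 by apply/eqP => zE; move: Nz0; rewrite zE N0 ltxx.
have E n' x y : y * z = x -> N y * rho ^+ n' = N x * rho ^+ n' / N z.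
  by move=> <-; rewrite NM mulrAC mulfK // gt_eqF.
have B0 : 0 <= B by apply: le_trans (vB 0%N); rewrite mulr_ge0 // exprn_ge0 // ltW.
have key x : N (x / z) * N z = N x by rewrite -NM mulfVK.
set M := B / _; have ME : B + M * rho = M * N z by rewrite /M; field; lra.
elim: n => [|n IH]; rewrite -(ler_pM2r Nz0) mulrAC key.
  rewrite NN -ME; apply: le_trans (vB 0%N) _.
  by rewrite lerDl mulr_ge0 ?divr_ge0 // ltW.
apply: (@le_trans _ _ ((N (linear_quot z v n) + N (v n.+1)) * rho ^+ n.+1)).
  by rewrite ler_wpM2r ?exprn_ge0 ?(ltW rho_gt0) // -(NN (v n.+1)) ND.
rewrite mulrDl addrC -ME; apply: lerD; first exact: vB.
by rewrite exprSr mulrA ler_wpM2r // ltW.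
Qed.

Lemma linear_quotP z v n : z != 0 -> mulX (linear_quot z v) n - z * linear_quot z v n = v n.
Proof. by move=> z0; case: n => [|n] /=; rewrite mulrC mulfVK //; ring. Qed.

(** If all roots of a polynomial have absolute value above [rho], the power
    series of v divided by this polynomial inherits the boundedness of v. Only
    coefficients below [M] matter, so the truncation of u to degree below [M] is
    enough to state the product as one of polynomials. *)
Lemma bounded_quotient (s : seq K) v B : all (fun z => rho < N z) s ->
  (forall n, N (v n) * rho ^+ n <= B) ->
  exists u B', (forall n, N (u n) * rho ^+ n <= B') /\
    forall M m, (m < M)%N -> (\prod_(z <- s) ('X - z%:P) * \poly_(i < M) u i)`_m = v m.
Proof.
elim: s v B => [|z s IH] v B /=.
  by move=> _ vB; exists v, B; split => // M m mM; rewrite big_nil mul1r coef_poly mM.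
move=> /andP[rz rs] vB.
have z0 : z != 0.
  by apply/eqP => zE; move: rz; rewrite zE N0 ltNge (ltW rho_gt0).
have [B1 wB] := linear_quot_bounded rz vB.
have [u [B' [uB uE]]] := IH _ _ rs wB; exists u, B'; split => // M m mM.
rewrite big_cons -mulrA mulrBl coefB coefXM coefCM (uE M m mM) -[RHS](linear_quotP v m z0).
by congr (_ - _); case: m mM => // m mM /=; rewrite uE // ltnW.
Qed.

(** Solving the equation of index n + k for the dominant term bounds u_k by
    t sup |u| with t < 1, in the weight rho^k. *)
Lemma dominant_coefficient_bounded_eq0 (a u : nat -> K) (n : nat) (S B : R) :
  (forall M, \sum_(i < M | i != n :> nat) N (a i) * rho ^+ i <= S) ->
  S < N (a n) * rho ^+ n ->
  (forall k, N (u k) * rho ^+ k <= B) ->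
  (forall k, \sum_(i < (n + k).+1) a i * u (n + k - i)%N = 0) ->
  forall k, u k = 0.
Proof.
move=> aS Sn uB conv.
have S0 : 0 <= S by have := aS 0%N; rewrite big_ord0.
have A0 : 0 < N (a n) * rho ^+ n by apply: le_lt_trans Sn.
have B0 : 0 <= B by apply: le_trans (uB 0%N); rewrite mulr_ge0 // exprn_ge0 // ltW.
set t := S / (N (a n) * rho ^+ n).
have t0 : 0 <= t by rewrite divr_ge0 // ltW.
have t1 : t < 1 by rewrite ltr_pdivrMr // mul1r.
have step j k : N (u k) * rho ^+ k <= t ^+ j * B.
  elim: j k => [|j IH] k; first by rewrite expr0 mul1r.
  have tB : 0 <= t ^+ j * B by rewrite mulr_ge0 ?exprn_ge0.
  have -> : t ^+ j.+1 * B = S * (t ^+ j * B) / (N (a n) * rho ^+ n).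
    by rewrite exprS /t; ring.
  rewrite ler_pdivlMr // mulrACA -exprD -NM addnC.
  have nk : (n < (n + k).+1)%N by rewrite ltnS leq_addr.
  have := conv k; rewrite (bigD1 (Ordinal nk)) //= addKn => /eqP.
  rewrite addr_eq0 mulrC => /eqP ->; rewrite NN.
  apply: le_trans (ler_wpM2r _ (abs_sum _ _ _)) _; first by rewrite exprn_ge0 // ltW.
  rewrite mulr_suml.
  apply: le_trans (ler_wpM2r tB (aS (n + k).+1)); rewrite mulr_suml.
  apply: ler_sum => i _.
  have ik : (i <= n + k)%N by rewrite -ltnS.
  have rE : rho ^+ (n + k) = rho ^+ i * rho ^+ (n + k - i) by rewrite -exprD subnKC.
  by rewrite NM rE mulrACA ler_wpM2l // mulr_ge0 // exprn_ge0 // ltW.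
move=> k; apply: N_eq0; apply/eqP; rewrite eq_le N_ge0 andbT.
have rk : 0 < rho ^+ k by rewrite exprn_gt0.
rewrite -(ler_pM2r rk) mul0r; exact: (le_geometric_le0 t0 t1 (fun j => step j k)).
Qed.

(** The lower bound in the theorem of Pellet. With fewer than n small roots,
    p = q h where deg q < n and h has the large roots; the series of 1/h then
    satisfies the equations of the preceding lemma, although its constant
    coefficient is not 0. *)
Lemma dominant_coefficient_roots p n (S : R) :
  (forall M, \sum_(i < M | i != n :> nat) N p`_i * rho ^+ i <= S) ->
  S < N p`_n * rho ^+ n ->
  exists s q, [/\ size s = n, all (fun z => N z <= rho) s
    & p = \prod_(z <- s) ('X - z%:P) * q].
Proof.
move=> pS Sn.
have [rs prs] := closed_field_poly_normal p.
pose small z := N z <= rho.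
have {}prs : p = \prod_(z <- seq.filter small rs) ('X - z%:P) *
    (lead_coef p *: \prod_(z <- seq.filter (predC small) rs) ('X - z%:P)).
  by rewrite {1}prs -scalerAr !big_filter; congr (_ *: _); rewrite (bigID small).
have [ns|sn] := leqP n (size (seq.filter small rs)).
  set s1 := seq.filter small rs in prs ns.
  exists (take n s1), (\prod_(z <- drop n s1) ('X - z%:P) *
    (lead_coef p *: \prod_(z <- seq.filter (predC small) rs) ('X - z%:P))); split.
  - by rewrite size_takel.
  - by apply/allP => z /mem_take; rewrite mem_filter => /andP[].
  - by rewrite mulrA -big_cat cat_take_drop.
exfalso.
set h := \prod_(z <- seq.filter (predC small) rs) ('X - z%:P) in prs.
set s1 := seq.filter small rs in prs sn.
pose q := lead_coef p *: \prod_(z <- s1) ('X - z%:P).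
have pE : p = q * h by rewrite {1}prs /q -scalerAl -scalerAr.
have large : all (fun z => rho < N z) (seq.filter (predC small) rs).
  by apply: sub_all (seq.filter_all _ _) => z /=; rewrite /small ltNge.
have [|u [B [uB uE]]] := @bounded_quotient _ (fun m => (m == 0%N)%:R) (N 1) large.
  by case=> [|m] /=; rewrite ?expr0 ?mulr1 // N0 mul0r.
have u0 : u 0%N = 0.
  apply: (dominant_coefficient_bounded_eq0 pS Sn uB) => k.
  have := coefM p (\poly_(i < (n + k).+1) u i) (n + k).
  rewrite (eq_bigr (fun i : 'I_(n + k).+1 => p`_i * u (n + k - i)%N)); last first.
    by move=> i _; rewrite coef_poly ltnS leq_subr.
  move=> <-; rewrite pE -mulrA coefM big1 // => i _.
  rewrite uE; last by rewrite ltnS leq_subr.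
  have [ik|ik] := eqVneq (n + k - i)%N 0%N; last by rewrite mulr0.
  rewrite /q coefZ nth_default ?mulr0 ?mul0r // size_prod_XsubC.
  apply: (leq_trans sn); rewrite (leq_trans (leq_addr k n)) //.
  by rewrite -subn_eq0 ik.
have := uE 1%N 0%N isT; rewrite coefM big_ord1 /= coef_poly /= u0 mulr0 => /esym/eqP.
by rewrite oner_eq0.
Qed.
End dominant_coefficient.

Section dominant_power_series.
Context (R : realType).
Local Notation C := (Num.NumField.sort (complex_complex__canonical__Num_NumField R)).
Implicit Types (z l m : C) (c d g : nat -> C) (rho s B e r : R).

Lemma psum_finite c M z : (forall n, (M <= n)%N -> c n = 0) ->
  power_series_sum c z = \sum_(i < M) c i * z ^+ i.
Proof.
move=> c0; apply/cvg_lim; first exact: norm_hausdorff.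
apply: cvg_near_cst; exists M => // n /= Mn.
rewrite /series /= (big_cat_nat (n := M)) //= big_mkord -[RHS]addr0; congr (_ + _).
by rewrite big_nat_cond big1 // => i /andP[/andP[Mi _] _]; rewrite c0 // mul0r.
Qed.

Definition truncation M c : nat -> C := fun n => if (n < M)%N then c n else 0.

Lemma truncation_close rho rho' B c e : 0 < rho -> rho < rho' ->
  weight_bounded rho' B c -> 0 < e ->
  exists M0, forall M, (M0 <= M)%N -> weight_bounded rho e (fun n => truncation M c n - c n).
Proof.
move=> r0 rr wB e0; have r'0 : 0 < rho' by apply: lt_trans rr.
have B0 := weight_bounded_ge0 wB.
have [B' wn] := weight_bounded_natmul r0 rr wB.
(* the terms are at most B' / n in the weight rho *)
exists (Num.truncn (B' / e)).+1 => M Mt n; rewrite /truncation.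
case: ltnP => nM; first by rewrite subrr normc0 mul0r ltW.
rewrite sub0r normCN.
have n0 : (0 < n)%N by apply: leq_trans nM; apply: leq_trans Mt.
have nR : 0 < n%:R :> R by rewrite ltr0n.
rewrite -(ler_pM2r nR).
have := wn n; rewrite normCMn mulrnAl -mulr_natr => h; apply: (le_trans h).
rewrite mulrC -ler_pdivrMr //; apply/ltW/(lt_le_trans (truncnS_gt _)).
by rewrite ler_nat (leq_trans Mt).
Qed.

Lemma quot_poly (p q : {poly C}) l : p = ('X - l%:P) * q ->
  quot (fun n => p`_n) l = (fun n => q`_n).
Proof.
move=> pq.
have cE k : p`_k.+1 = q`_k - l * q`_k.+1 by rewrite pq mulrBl coefB coefXM coefCM.
have wp : weight_bounded (normc l + 1) (\sum_(i < size p) normc p`_i * (normc l + 1) ^+ i) (fun n => p`_n).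
  move=> n; have r1 : 0 <= normc l + 1 by rewrite addr_ge0 // normc_ge0.
  have pos i : 0 <= normc p`_i * (normc l + 1) ^+ i by rewrite mulr_ge0 ?normc_ge0 ?exprn_ge0.
  have [pn|np] := leqP (size p) n.
    by rewrite nth_default // normc0 mul0r sumr_ge0.
  by rewrite (bigD1 (Ordinal np)) //= lerDl sumr_ge0.
have lr : normc l < normc l + 1 by rewrite ltrDl.
have big n : (size p + size q <= n)%N -> quot (fun n => p`_n) l n = q`_n.
  move=> sn; rewrite [RHS]nth_default; last by apply: leq_trans sn; rewrite leq_addl.
  rewrite /quot (psum_finite (M := 0)) ?big_ord0 // => j _.
  rewrite nth_default //; apply: leq_trans (leq_trans sn _); first exact: leq_addr.
  by rewrite addSnnS leq_addr.
apply/funext => n.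
have [k nk] : exists k, (size p + size q <= n + k)%N by exists (size p + size q)%N; exact: leq_addl.
elim: k n nk => [|k IH] n nk; first by apply: big; rewrite addn0 in nk.
rewrite (quot_rec n wp lr) IH; last by rewrite addSnnS.
by rewrite cE addrNK.
Qed.

Lemma poly_roots_approx_zeros (p q : {poly C}) (s : seq C) rho :
  all (fun z => normc z <= rho) s -> p = \prod_(z <- s) ('X - z%:P) * q ->
  approx_zeros (size s) rho 0 (fun n => p`_n).
Proof.
elim: s p => //= z s IH p /andP[zr sr]; rewrite big_cons -mulrA => pE.
exists z; split => //.
  rewrite (psum_finite (M := size p)); last by move=> n; exact: nth_default.
  by rewrite -horner_coef pE hornerM hornerXsubC subrr mul0r normc0.
by rewrite (quot_poly pE); exact: IH.
Qed.

(** The dominance persists at a slightly smaller radius [s], where it holds for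
    all truncations with the same [s]; their roots in the closed disk of radius
    [s] then pass to the limit. *)
Lemma dominant_coefficient_zeros c n r (S : R) : 0 < r ->
  (forall M, \sum_(i < M | i != n :> nat) normc (c i) * r ^+ i <= S) ->
  S < normc (c n) * r ^+ n ->
  exists2 s, s < r & approx_zeros n s 0 c.
Proof.
move=> r0 cS Sn.
have [s [s0 sr Ss]] : exists s, [/\ 0 < s, s < r & S < normc (c n) * s ^+ n].
  have cont : (normc (c n) * x ^+ n) @[x --> r^'-] --> normc (c n) * r ^+ n.
    apply: cvg_at_left_filter; apply: cvgM; first exact: cvg_cst.
    exact: exprn_continuous.
  have h1 : \forall x \near r^'-, S < normc (c n) * x ^+ n by exact: (cvgr_gt _ cont _ Sn).
  have h2 : \forall x \near r^'-, 0 < x by exact: nbhs_left_gt.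
  have h3 : \forall x \near r^'-, x < r by exact: nbhs_left_lt.
  by have [x [? [? ?]]] := filter_ex (filterI h1 (filterI h2 h3)); exists x.
exists s => //.
have wc : weight_bounded r (S + normc (c n) * r ^+ n) c.
  move=> k.
  have pos i : 0 <= normc (c i) * r ^+ i by rewrite mulr_ge0 ?normc_ge0 ?exprn_ge0 ?(ltW r0).
  have S0 : 0 <= S by have := cS 0%N; rewrite big_ord0.
  have [->|kn] := eqVneq k n; first by rewrite lerDr.
  apply: (@le_trans _ _ S); last by rewrite lerDl.
  apply: le_trans (cS k.+1); rewrite (bigD1 ord_max) //= lerDl.
  by apply: sumr_ge0 => i _; exact: pos.
have [rho [h1 h2]] : exists rho, s < rho /\ rho < r by exists ((s + r) / 2); lra.
have rho0 := lt_trans s0 h1.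
have wr : weight_bounded rho (S + normc (c n) * r ^+ n) c.
  move=> k; apply: le_trans (wc k); rewrite ler_wpM2l ?normc_ge0 //.
  by rewrite lerXn2r ?nnegrE ?(ltW r0) ?(ltW rho0) ?(ltW h2).
apply: (approx_zeros_closed h1 wr) => e e0.
have [M0 HM] := truncation_close rho0 h2 wc e0.
pose M := maxn M0 n.+1.
exists (truncation M c); first by apply: HM; rewrite leq_maxl.
pose p : {poly C} := \poly_(i < M) c i.
have pE : truncation M c = fun i => p`_i by apply/funext => i; rewrite coef_poly.
have [||t [q [st ts pq]]] := @dominant_coefficient_roots R C (@normc R) (@normc_ge0 R)
  (@eq0_normc R) (@normc0 R) (@normCM R) (@normCN R) (@ler_normcD R) s s0 p n S.
- move=> k; apply: le_trans (cS k); apply: ler_sum => i _.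
  rewrite coef_poly; case: ifP => _; last first.
    by rewrite normc0 mul0r mulr_ge0 ?normc_ge0 ?exprn_ge0 ?(ltW r0).
  rewrite ler_wpM2l ?normc_ge0 //.
  by rewrite lerXn2r ?nnegrE ?(ltW r0) ?(ltW s0) ?(ltW sr).
- by rewrite coef_poly leq_max ltnSn orbT.
rewrite pE -st; apply: approx_zeros_le (poly_roots_approx_zeros ts pq) => //.
exact: ltW.
Qed.

End dominant_power_series.

(** * Measurability of the zero count *)

Section measurability.
Context (R : realType) (dsp : measure_display) (T : measurableType dsp).
Local Notation C := (Num.NumField.sort (complex_complex__canonical__Num_NumField R)).
Implicit Types (X Y : T -> C) (U : nat -> T -> C) (s e r x : R).

Definition complex_measurable X :=
  measurable_fun setT (fun w => complex.Re (X w)) /\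
  measurable_fun setT (fun w => complex.Im (X w)).

Lemma complex_measurable_cst (c : C) : complex_measurable (fun _ => c).
Proof. by split; exact: measurable_cst. Qed.

Lemma complex_measurableD X Y : complex_measurable X -> complex_measurable Y ->
  complex_measurable (fun w => X w + Y w).
Proof.
move=> [X1 X2] [Y1 Y2]; split.
  have -> : (fun w => complex.Re (X w + Y w)) = (fun w => complex.Re (X w)) \+ (fun w => complex.Re (Y w)).
    by apply/funext => w /=; case: (X w) => a b; case: (Y w).
  exact: measurable_funD.
have -> : (fun w => complex.Im (X w + Y w)) = (fun w => complex.Im (X w)) \+ (fun w => complex.Im (Y w)).
  by apply/funext => w /=; case: (X w) => a b; case: (Y w).
exact: measurable_funD.
Qed.

Lemma complex_measurableM X Y : complex_measurable X -> complex_measurable Y ->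
  complex_measurable (fun w => X w * Y w).
Proof.
move=> [X1 X2] [Y1 Y2]; split.
  have -> : (fun w => complex.Re (X w * Y w)) =
     ((fun w => complex.Re (X w)) \* (fun w => complex.Re (Y w))) \-
     ((fun w => complex.Im (X w)) \* (fun w => complex.Im (Y w))).
    by apply/funext => w /=; case: (X w) => a b; case: (Y w).
  by apply: measurable_funB; apply: measurable_funM.
have -> : (fun w => complex.Im (X w * Y w)) =
     ((fun w => complex.Re (X w)) \* (fun w => complex.Im (Y w))) \+
     ((fun w => complex.Im (X w)) \* (fun w => complex.Re (Y w))).
  by apply/funext => w /=; case: (X w) => a b; case: (Y w).
by apply: measurable_funD; apply: measurable_funM.
Qed.

Lemma complex_measurable_sum n (F : nat -> T -> C) :
  (forall i, complex_measurable (F i)) -> complex_measurable (fun w => \sum_(i < n) F i w).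
Proof.
move=> HF; elim: n => [|n IH].
  under eq_fun do rewrite big_ord0.
  exact: complex_measurable_cst.
under eq_fun do rewrite big_ord_recr /=.
exact: complex_measurableD.
Qed.

Lemma measurable_normc_le X e : complex_measurable X ->
  measurable [set w | normc (X w) <= e].
Proof.
move=> [X1 X2]; have [e0|e0] := leP 0 e; last first.
  rewrite (_ : [set _ | _] = set0) //; apply/seteqP; split => // w /=.
  by move=> h; have := le_lt_trans h e0; rewrite ltNge normc_ge0.
pose g w := complex.Re (X w) ^+ 2 + complex.Im (X w) ^+ 2.
have gm : measurable_fun setT g by apply: measurable_funD; exact: measurable_funX.
have -> : [set w | normc (X w) <= e] = setT `&` g @^-1` `]-oo, e ^+ 2]%classic.
  rewrite setTI; apply/seteqP; split => w /=; rewrite in_itv /= /g -normc_sqr.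
    by move=> h; rewrite ler_pXn2r ?nnegrE ?normc_ge0.
  by rewrite ler_pXn2r ?nnegrE ?normc_ge0.
exact: gm.
Qed.

Lemma measurable_rational_zeros k s e M U : (forall n, complex_measurable (U n)) ->
  (forall n w, (M <= n)%N -> U n w = 0) ->
  measurable [set w | rational_zeros k s e (fun n => U n w)].
Proof.
elim: k U => [|k IH] U Um U0; first exact: measurableT.
have -> : [set w | rational_zeros k.+1 s e (fun n => U n w)] =
  \bigcup_(q in [set: rat * rat]) ([set w | normc (rat_complex R q) <= s] `&`
    ([set w | normc (power_series_sum (fun n => U n w) (rat_complex R q)) <= e] `&`
     [set w | rational_zeros k s e (quot (fun n => U n w) (rat_complex R q))])).
  apply/seteqP; split => w.
    by move=> [q [h1 h2 h3]]; exists q.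
  by move=> [q _ [h1 [h2 h3]]]; exists q; split.
have psumE q (V : nat -> T -> C) : (forall n w, (M <= n)%N -> V n w = 0) ->
    (fun w => power_series_sum (fun n => V n w) q) = fun w => \sum_(i < M) (V i w * q ^+ i).
  by move=> V0; apply/funext => w; apply: psum_finite => n Mn; exact: V0.
apply: countable_bigcupT_measurable => [|q]; first exact: countableP.
apply: measurableI.
  by have [h|h] := boolP (normc (rat_complex R q) <= s);
    [rewrite (_ : [set _ | _] = setT) //; apply/seteqP; split|
     rewrite (_ : [set _ | _] = set0) //; apply/seteqP; split].
apply: measurableI.
  apply: measurable_normc_le; rewrite psumE //.
  apply: (@complex_measurable_sum M (fun i w => U i w * rat_complex R q ^+ i)) => i.
  by apply: complex_measurableM => //; exact: complex_measurable_cst.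
apply: (IH (fun n w => quot (fun n => U n w) (rat_complex R q) n)) => [n|n w Mn].
  rewrite /quot (psumE _ (fun j w => U (n.+1 + j)%N w)); last first.
    by move=> j w Mj; apply: U0; apply: (leq_trans Mj); rewrite leq_addl.
  apply: (@complex_measurable_sum M (fun i w => U (n.+1 + i)%N w * rat_complex R q ^+ i)) => i.
  by apply: complex_measurableM => //; exact: complex_measurable_cst.
rewrite /quot (psum_finite (M := 0)) ?big_ord0 // => j _; apply: U0.
by apply: (leq_trans Mn); rewrite addSnnS leq_addr.
Qed.

Definition inner_radius r (i : nat) := r * (1 - i.+2%:R^-1).

Lemma inner_radius_gt0 r i : 0 < r -> 0 < inner_radius r i.
Proof.
move=> r0; rewrite mulr_gt0 // subr_gt0 invf_lt1 ?ltr0n //.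
by rewrite ltr1n.
Qed.

Lemma inner_radius_lt r i : 0 < r -> inner_radius r i < r.
Proof. by move=> r0; rewrite -[ltRHS]mulr1 ltr_pM2l // gtrBl invr_gt0 ltr0n. Qed.

Lemma inner_radius_gt r s : 0 < r -> s < r -> exists i, s < inner_radius r i.
Proof.
move=> r0 sr; exists (Num.truncn (r / (r - s))).
have d0 : 0 < r - s by rewrite subr_gt0.
have := truncnS_gt (r / (r - s)); set n := Num.truncn _ => h.
have h2 : r / (r - s) < n.+2%:R by apply: lt_trans h _; rewrite ltr_nat.
rewrite /inner_radius mulrBr mulr1 ltrBrDr -ltrBrDl ltr_pdivrMr ?ltr0n //.
by rewrite mulrC -ltr_pdivrMr.
Qed.

(** Countably many radii and integer bounds suffice, which makes convergence in
    the disk a measurable event. *)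
Lemma converges_in_diskE r (c : nat -> C) : 0 < r ->
  converges_in_disk r c <->
  forall i, exists b : nat, weight_bounded (inner_radius r i) b%:R c.
Proof.
move=> r0; split => [H i|H rho rho0 rr].
  have [B wB] := H _ (inner_radius_gt0 i r0) (inner_radius_lt i r0).
  exists (Num.truncn B).+1; apply: weight_bounded_le wB _.
  exact/ltW/truncnS_gt.
have [i ri] := inner_radius_gt r0 rr; have [b wb] := H i.
exists b%:R => n; apply: le_trans (wb n); rewrite ler_wpM2l ?normc_ge0 //.
by rewrite lerXn2r ?nnegrE ?(ltW rho0) ?(ltW ri) ?(ltW (inner_radius_gt0 i r0)).
Qed.

Lemma measurable_converges r U : 0 < r -> (forall n, complex_measurable (U n)) ->
  measurable [set w | converges_in_disk r (fun n => U n w)].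
Proof.
move=> r0 Um.
have -> : [set w | converges_in_disk r (fun n => U n w)] =
  \bigcap_i \bigcup_b \bigcap_n
    [set w | normc (U n w * (inner_radius r i ^+ n)%:C%C) <= b%:R].
  apply/seteqP; split => w /=.
    move=> /(converges_in_diskE _ r0) H i _; have [b wb] := H i; exists b => // n _ /=.
    rewrite normCM normc_real ger0_norm; first exact: wb.
    by rewrite exprn_ge0 // ltW // inner_radius_gt0.
  move=> H; apply/(converges_in_diskE _ r0) => i.
  have [b _ Hb] := H i I; exists b => n; have := Hb n I.
  rewrite /= normCM normc_real ger0_norm //.
  by rewrite exprn_ge0 // ltW // inner_radius_gt0.
apply: bigcapT_measurable => i; apply: bigcupT_measurable => b.
apply: bigcapT_measurable => n; apply: measurable_normc_le.
by apply: complex_measurableM => //; exact: complex_measurable_cst.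
Qed.

(** Zeros of the limit in terms of approximate zeros of truncations: this
    replaces the open disk and the exact equations by countable data. *)
Lemma approx_zeros_rationalP k r (c : nat -> C) : 0 < r -> converges_in_disk r c ->
  (exists2 s, s < r & approx_zeros k s 0 c) <->
  (exists i, forall p, exists2 M, (p <= M)%N &
     rational_zeros k (inner_radius r i) p.+1%:R^-1 (truncation M c)).
Proof.
move=> r0 H; split => [[s sr az]|[i Hi]].
  have [i si] := inner_radius_gt r0 sr; exists i => p.
  have ri := inner_radius_lt i r0; have i0 := inner_radius_gt0 i r0.
  have [rho [B [h1 h2 wB]]] := converges_between (ltW i0) ri H.
  have p0 : 0 < p.+1%:R^-1 :> R by rewrite invr_gt0 ltr0n.
  have [rho1 [h3 h4]] : exists rho1, inner_radius r i < rho1 /\ rho1 < rho.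
    by exists ((inner_radius r i + rho) / 2); lra.
  have wB1 : weight_bounded rho1 B c.
    have rho10 := lt_trans i0 h3.
    move=> n; apply: le_trans (wB n); rewrite ler_wpM2l ?normc_ge0 //.
    by rewrite lerXn2r ?nnegrE ?(ltW rho10) ?(ltW h4) ?(ltW (lt_trans rho10 h4)).
  have [eta' eta'0 Heta'] := approx_zeros_perturb si h3 p0 wB1 az.
  have [M0 HM] := truncation_close (lt_trans i0 h3) h4 wB eta'0.
  by exists (maxn M0 p); rewrite ?leq_maxr //; apply: Heta'; apply: HM; rewrite leq_maxl.
have ri := inner_radius_lt i r0; have i0 := inner_radius_gt0 i r0.
exists (inner_radius r i) => //.
have [rho [B [h1 h2 wB]]] := converges_between (ltW i0) ri H.
have rho0 := lt_trans i0 h1.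
apply: (approx_zeros_closed h1 wB) => e e0.
have [rho1 [B1 [h3 _ wB1]]] := converges_between (ltW rho0) h2 H.
have [M0 HM] := truncation_close rho0 h3 wB1 e0.
have [M pM rz] := Hi (maxn M0 (Num.truncn e^-1)).
exists (truncation M c); first by apply: HM; apply: leq_trans pM; exact: leq_maxl.
apply: approx_zeros_le (rational_approx_zeros rz) => //.
rewrite -[leRHS]invrK lef_pV2 ?posrE ?invr_gt0 ?ltr0n //.
apply/ltW/(lt_le_trans (truncnS_gt _)).
by rewrite ler_nat ltnS leq_maxr.
Qed.

Lemma measurable_zero_count_ge U r x k : 0 < r -> (forall n, complex_measurable (U n)) ->
  k%:R - 1 < x -> x <= k%:R ->
  measurable [set w | (x%:E <= zero_count (power_series_sum (fun n => U n w)) r)%E].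
Proof.
move=> r0 Um kx xk.
set D := [set w | converges_in_disk r (fun n => U n w)].
have -> : [set w | (x%:E <= zero_count (power_series_sum (fun n => U n w)) r)%E] =
   ~` D `|` (D `&` \bigcup_i \bigcap_p \bigcup_(M in [set M | (p <= M)%N])
     [set w | rational_zeros k (inner_radius r i) p.+1%:R^-1 (fun n => (if (n < M)%N then U n w else 0))]).
  apply/seteqP; split => w.
    move=> /= zc; have [Dw|nD] := pselect (D w); last by left.
    right; split => //.
    have [i Hi] := (approx_zeros_rationalP k r0 Dw).1 ((zero_count_geP Dw kx xk).1 zc).
    exists i => // p _; have [M pM rz] := Hi p; exists M => //.
  case=> [nD|[Dw [i _ Hi]]] /=; first by rewrite zero_count_divergent // leey.
  apply/(zero_count_geP Dw kx xk)/(approx_zeros_rationalP k r0 Dw).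
  by exists i => p; have [M pM rz] := Hi p I; exists M.
have mD : measurable D by exact: measurable_converges.
apply: measurableU; first exact: measurableC.
apply: measurableI => //; apply: bigcupT_measurable => i.
apply: bigcapT_measurable => p; apply: bigcup_measurable => M _.
apply: (@measurable_rational_zeros k _ _ M (fun n w => if (n < M)%N then U n w else 0)).
  by move=> n; case: (n < M)%N => //; exact: complex_measurable_cst.
by move=> n w Mn; rewrite ltnNge Mn.
Qed.

End measurability.

(** * Estimates for the complex Gaussian law *)

Section gaussian_estimates.
Context (R : realType).
Notation mu := (@lebesgue_measure R).
Notation mR := (measurableTypeR R).
Implicit Types (s x y m : R).

Definition plane_density (p : mR * mR) : R := pi^-1 * expR (- (p.1 ^+ 2 + p.2 ^+ 2)).

Definition plane_disk s : set (mR * mR) := [set p | p.1 ^+ 2 + p.2 ^+ 2 <= s ^+ 2].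

Definition plane_outside : set (mR * mR) := [set p | 1 <= p.1 ^+ 2 + p.2 ^+ 2].

Lemma measurable_sqr_norm : measurable_fun [set: mR * mR]
  (fun p : mR * mR => p.1 ^+ 2 + p.2 ^+ 2 : R).
Proof.
apply: measurable_funD; apply: measurable_funX.
  exact: measurable_fst.
exact: measurable_snd.
Qed.

Lemma measurable_plane_disk s : measurable (plane_disk s).
Proof.
have -> : plane_disk s = setT `&`
    (fun p : mR * mR => p.1 ^+ 2 + p.2 ^+ 2 : R) @^-1` `]-oo, s ^+ 2]%classic.
  by rewrite setTI; apply/seteqP; split => p /=; rewrite in_itv.
exact: measurable_sqr_norm.
Qed.

Lemma measurable_plane_outside : measurable plane_outside.
Proof.
have -> : plane_outside = setT `&`
    (fun p : mR * mR => p.1 ^+ 2 + p.2 ^+ 2 : R) @^-1` `[1, +oo[%classic.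
  by rewrite setTI; apply/seteqP; split => p /=; rewrite in_itv /= andbT.
exact: measurable_sqr_norm.
Qed.

Lemma measurable_plane_density : measurable_fun [set: mR * mR] plane_density.
Proof.
apply: measurable_funM => //; apply: measurableT_comp => //.
by apply: measurableT_comp => //; exact: measurable_sqr_norm.
Qed.

Lemma plane_density_ge0 p : 0 <= plane_density p.
Proof. by rewrite mulr_ge0 ?invr_ge0 ?pi_ge0 ?expR_ge0. Qed.

Lemma rectangle_integral_ge (B : set (mR * mR)) (a b c d m : R) : measurable B ->
  a < b -> c < d -> 0 <= m ->
  (forall x y, a <= x <= b -> c <= y <= d -> B (x, y) /\ m <= plane_density (x, y)) ->
  ((m * ((b - a) * (d - c)))%:E <= \int[mu \x mu]_(p in B) (plane_density p)%:E)%E.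
Proof.
move=> mB ab cd m0 H.
pose Q : set (mR * mR) := `[a, b]%classic `*` `[c, d]%classic.
have mQ : measurable Q by apply: measurableX; exact: measurable_itv.
have QB : Q `<=` B.
  by move=> [x y] [] /=; rewrite !in_itv /= => h1 h2; have [] := H x y h1 h2.
have mf D : measurable_fun D (fun p => (plane_density p)%:E).
  by apply/measurable_EFinP; exact: measurable_funTS measurable_plane_density.
have f0 (p : mR * mR) : B p -> (0 <= (plane_density p)%:E)%E.
  by move=> _; rewrite lee_fin plane_density_ge0.
apply: (le_trans _ (ge0_subset_integral (mu \x mu)%E mQ mB (mf B) f0 QB)).
have -> : (m * ((b - a) * (d - c)))%:E = (\int[mu \x mu]_(p in Q) cst m%:E p)%E.
  rewrite integral_cst //.
  rewrite EFinM; congr (_ * _)%E; apply: esym.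
  have mI (i : interval R) : measurable ([set` i] : set mR) by exact: measurable_itv.
  have E := @product_measure1E _ _ mR mR R mu mu _ _ (mI `[a, b]) (mI `[c, d]).
  apply: (etrans E).
  have L (u v : R) : u < v -> mu (`[u, v]%classic : set mR) = (v - u)%:E.
    by move=> uv; have := lebesgue_measure_itv `[u, v]; rewrite /= lte_fin uv -EFinB.
  rewrite EFinM; congr (_ * _)%E; exact: L.
apply: ge0_le_integral => //.
move=> [x y] [] /=; rewrite !in_itv /= => h1 h2; rewrite lee_fin.
by have [] := H x y h1 h2.
Qed.

(** The total mass of the standard Gaussian law of the plane, used as a
    reference measure for the tail estimate. *)
Lemma integral_normal_product :
  (\int[mu \x mu]_p (normal_pdf 0 1 p.1 * normal_pdf 0 1 p.2)%:E = 1)%E.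
Proof.
have mh := measurable_normal_pdf (0 : R) 1.
rewrite fubini_tonelli1 /=; last 2 first.
- by apply/measurable_EFinP; apply: measurable_funM; apply: measurableT_comp => //.
- by move=> p; rewrite lee_fin mulr_ge0 // normal_pdf_ge0.
rewrite -[RHS](integral_normal_pdf (0 : R) 1); apply: eq_integral => x _.
rewrite /fubini_F /=; under eq_integral do rewrite EFinM.
rewrite ge0_integralZl_EFin //.
- by rewrite integral_normal_pdf mule1.
- by move=> y _; rewrite lee_fin normal_pdf_ge0.
- exact/measurable_EFinP.
- exact: normal_pdf_ge0.
Qed.

Lemma normal_productE x y : normal_pdf 0 1 x * normal_pdf 0 1 y =
  (pi *+ 2)^-1 * expR (- (x ^+ 2 + y ^+ 2) / 2).
Proof.
rewrite normal_pdfE ?oner_eq0 // /normal_peak /normal_fun !subr0 expr1n mul1r.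
rewrite mulrACA -expRD -invfM -expr2 sqr_sqrtr; last by rewrite mulrn_wge0 // pi_ge0.
by congr (_ * expR _); lra.
Qed.

(** Half of the exponent is at most - s^2 / 2 outside the disk; what is left is
    a multiple of the standard Gaussian density of the plane. *)
Lemma plane_tail s : (\int[mu \x mu]_(p in ~` plane_disk s) (plane_density p)%:E <=
  (2 * expR (- s ^+ 2 / 2))%:E)%E.
Proof.
have mD := measurableC (measurable_plane_disk s).
have mh := measurable_normal_pdf (0 : R) 1.
have mhh D : measurable_fun D (fun p : mR * mR => (normal_pdf 0 1 p.1 * normal_pdf 0 1 p.2)%:E).
  apply/measurable_EFinP; apply: measurable_funTS.
  by apply: measurable_funM; apply: measurableT_comp.
have c0 : 0 <= 2 * expR (- s ^+ 2 / 2) by rewrite mulr_ge0 ?expR_ge0.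
apply: (@le_trans _ _ (\int[mu \x mu]_(p in ~` plane_disk s)
   ((2 * expR (- s ^+ 2 / 2))%:E * (normal_pdf 0 1 p.1 * normal_pdf 0 1 p.2)%:E))%E).
  apply: ge0_le_integral => //.
  - by move=> p _; rewrite lee_fin plane_density_ge0.
  - by apply/measurable_EFinP; exact: measurable_funTS measurable_plane_density.
  - exact: measurable_funeM.
  move=> [x y] /= /negP; rewrite -ltNge => h; rewrite -EFinM lee_fin normal_productE.
  rewrite /plane_density /= mulrACA -expRD -(mulr_natr pi 2) invfM mulrCA mulfV // mulr1.
  rewrite ler_wpM2l ?invr_ge0 ?pi_ge0 // ler_expR; move: h => /= h; lra.
rewrite ge0_integralZl_EFin //; last by move=> p _; rewrite lee_fin mulr_ge0 // normal_pdf_ge0.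
rewrite -[leRHS]mule1 lee_wpmul2l ?lee_fin // -[leRHS]integral_normal_product.
apply: ge0_subset_integral => // p _.
by rewrite lee_fin mulr_ge0 // normal_pdf_ge0.
Qed.

Definition outer_prob : R := pi^-1 * expR (- 5).

Lemma outer_prob_gt0 : 0 < outer_prob.
Proof. by rewrite mulr_gt0 ?invr_gt0 ?pi_gt0 ?expR_gt0. Qed.

Lemma outer_prob_le1 : outer_prob <= 1.
Proof.
have pi1 : 1 <= pi :> R by have := @pi_ge2 R; lra.
rewrite /outer_prob -[leRHS]mulr1; apply: ler_pM.
- by rewrite invr_ge0 pi_ge0.
- exact: expR_ge0.
- by rewrite invf_le1 // pi_gt0.
- by rewrite expR_le1 oppr_le0.
Qed.

Section law.
Context (d : measure_display) (T : measurableType d) (P : probability T R) (X : T -> R[i]).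
Context (X_normal : standard_complex_normal P X).
Notation coord := (@complex_coord R \o X).

(** The square of side [s] is inside the disk, and the density is at least 1/8
    on it. *)
Lemma gaussian_small_ball s : 0 < s -> s <= 1 ->
  ((s ^+ 2 / 8)%:E <= P (coord @^-1` plane_disk s))%E.
Proof.
move=> s0 s1; have [_ ->] := X_normal; last exact: measurable_plane_disk.
have := @rectangle_integral_ge (plane_disk s) (- (s / 2)) (s / 2) (- (s / 2)) (s / 2) 8^-1
  (measurable_plane_disk s).
have -> : 8^-1 * ((s / 2 - - (s / 2)) * (s / 2 - - (s / 2))) = s ^+ 2 / 8 by field.
apply; try lra.
move=> x y; rewrite -!ler_norml => hx hy.
have sq z : `|z| <= s / 2 -> z ^+ 2 <= s ^+ 2 / 4.
  move=> h; rewrite -real_normK ?num_real //.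
  have -> : s ^+ 2 / 4 = (s / 2) ^+ 2 by field.
  by rewrite lerXn2r ?nnegrE //; lra.
have := sq x hx; have := sq y hy => h1 h2.
have s2 : s ^+ 2 <= 1 by rewrite expr_le1 // ltW.
split; first by rewrite /plane_disk /=; have := sqr_ge0 s; lra.
rewrite /plane_density /=.
have p4 : pi <= 4 :> R by have := @pihalf_lt2 R; lra.
have e2 : 1 / 2 <= expR (- (x ^+ 2 + y ^+ 2)).
  by have := expR_ge1Dx (- (x ^+ 2 + y ^+ 2)); lra.
have p0 : 0 < pi :> R := pi_gt0 R.
have pv : 4^-1 <= pi^-1 :> R by rewrite lef_pV2 ?posrE.
have -> : 8^-1 = 4^-1 * (1 / 2) :> R by field.
by apply: ler_pM => //; lra.
Qed.

Lemma gaussian_large_ball s :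
  ((1 - 2 * expR (- s ^+ 2 / 2))%:E <= P (coord @^-1` plane_disk s))%E.
Proof.
have [mX PX] := X_normal.
have mA : measurable (coord @^-1` plane_disk s).
  by rewrite -[X in measurable X]setTI; apply: mX => //; exact: measurable_plane_disk.
rewrite -[X in P X]setCK probability_setC; last exact: measurableC.
rewrite EFinB leeD2l // leeN2 preimage_setC PX; last exact: measurableC (measurable_plane_disk s).
exact: plane_tail.
Qed.

(** The constant is the least value of the density on the unit square
    [1, 2] x [0, 1]. *)
Lemma gaussian_outer : (outer_prob%:E <= P (coord @^-1` plane_outside))%E.
Proof.
have [_ ->] := X_normal; last exact: measurable_plane_outside.
have := @rectangle_integral_ge _ 1 2 0 1 (pi^-1 * expR (- 5)) measurable_plane_outside.
have -> : pi^-1 * expR (- 5) * ((2 - 1) * (1 - 0)) = pi^-1 * expR (- 5) :> R by ring.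
apply; try lra.
  by rewrite mulr_ge0 ?invr_ge0 ?pi_ge0 ?expR_ge0.
move=> x y /andP[x1 x2] /andP[y0 y1].
have hx1 : 1 <= x ^+ 2 by rewrite exprn_ege1.
have hx2 : x ^+ 2 <= 4 by nra.
have hy : y ^+ 2 <= 1 by rewrite expr_le1.
split; first by rewrite /plane_outside /=; have := sqr_ge0 y; lra.
apply: ler_wpM2l; first by rewrite invr_ge0 pi_ge0.
by rewrite ler_expR /=; lra.
Qed.

End law.
End gaussian_estimates.

(** * Probability that one term dominates *)

Section one_dominant_term.
Context (R : realType).
Implicit Types (r : R) (n N m : nat).

Definition gaf_weight r n : R := r ^+ n / Num.sqrt n`!%:R.

(** The part of the dominant term granted to the n-th term; the shares add up
    to 1. *)
Definition share n : R := (n.+1%:R * n.+2%:R)^-1.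

Definition threshold r N n : R := share n * (gaf_weight r N / gaf_weight r n).

Lemma gaf_weight_gt0 r n : 0 < r -> 0 < gaf_weight r n.
Proof. by move=> r0; rewrite /gaf_weight divr_gt0 ?exprn_gt0 // sqrtr_gt0 ltr0n fact_gt0. Qed.

Lemma share_gt0 n : 0 < share n.
Proof. by rewrite /share invr_gt0 mulr_gt0 ?ltr0n. Qed.

Lemma threshold_gt0 r N n : 0 < r -> 0 < threshold r N n.
Proof.
move=> r0; apply: mulr_gt0; first exact: share_gt0.
by apply: divr_gt0; exact: gaf_weight_gt0.
Qed.

Lemma sum_share m : \sum_(n < m) share n = 1 - m.+1%:R^-1.
Proof.
elim: m => [|m IH]; first by rewrite big_ord0 invr1 subrr.
rewrite big_ord_recr /= IH /share -!(natr1 m.+1) -!(natr1 m).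
have h : 0 <= m%:R :> R by rewrite ler0n.
by field; rewrite !gt_eqF //; lra.
Qed.

Lemma sum_share_but N m : \sum_(n < m | n != N :> nat) share n <= 1 - share N.
Proof.
apply: (@le_trans _ _ (\sum_(n < m + N.+1 | n != N :> nat) share n)).
  rewrite (big_ord_widen_cond (m + N.+1) (fun n => n != N) (fun n => share n)) ?leq_addr //.
  rewrite [leRHS](bigID (fun n : 'I__ => (n < m)%N)) /= lerDl sumr_ge0 // => i _.
  exact/ltW/share_gt0.
have Nm : (N < m + N.+1)%N by rewrite addnS ltnS leq_addl.
have := sum_share (m + N.+1); rewrite (bigD1 (Ordinal Nm)) //= => h.
have : 0 < (m + N.+1).+1%:R^-1 :> R by rewrite invr_gt0 ltr0n.
by move: h; move: (_.+1%:R^-1) (\sum_(_ < _ | _) _) => t S; lra.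
Qed.

Lemma prod_share_far m : 2^-1 <= \prod_(n < m) (1 - (n.+2%:R ^+ 2)^-1) :> R.
Proof.
have -> : \prod_(n < m) (1 - (n.+2%:R ^+ 2)^-1) = m.+2%:R / (2 * m.+1%:R) :> R.
  elim: m => [|m IH]; first by rewrite big_ord0 mulr1 mulfV // pnatr_eq0.
  rewrite big_ord_recr /= IH -!(natr1 m.+2) -!(natr1 m.+1) -!(natr1 m).
  have h : 0 <= m%:R :> R by rewrite ler0n.
  by field; rewrite !gt_eqF //; lra.
rewrite ler_pdivlMr ?mulr_gt0 ?ltr0n // mulrA mulVf ?pnatr_eq0 // mul1r.
by rewrite ler_nat.
Qed.

Section gaf.
Context (d : measure_display) (T : measurableType d) (P : probability T R)
  (a : nat -> T -> R[i]).
Context (a_normal : forall n, standard_complex_normal P (a n))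
  (a_indep : mutually_independent P a).
Notation mR := (measurableTypeR R).

(** Independence is about finite families; continuity from above gives the
    infinite intersection. *)
Lemma independent_bigcap (B : nat -> set (mR * mR)) (p : nat -> R) (q : R) :
  (forall n, measurable (B n)) -> (forall n, 0 <= p n) ->
  (forall n, ((p n)%:E <= P ((@complex_coord R \o a n) @^-1` B n))%E) ->
  (forall m, q <= \prod_(n < m) p n) ->
  (q%:E <= P (\bigcap_n ((@complex_coord R \o a n) @^-1` B n)))%E.
Proof.
move=> mB p0 pP qp.
pose A n := (@complex_coord R \o a n) @^-1` B n.
have mA n : measurable (A n).
  by rewrite /A -[X in measurable X]setTI; apply: (a_normal n).1.
pose F m := \bigcap_(n in [set` iota 0 m]) A n.
have iotaP m i : [set` iota 0 m] i <-> (i < m)%N.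
  by rewrite -[X in X <-> _]/(is_true (i \in iota 0 m)) mem_iota add0n.
have mF m : measurable (F m) by apply: fin_bigcap_measurable => //; exact: finite_seq.
have -> : \bigcap_n A n = \bigcap_m F m.
  apply/seteqP; split => w H.
    by move=> m _ n _; exact: H.
  by move=> n _; apply: (H n.+1 I); apply/iotaP.
have cv : (P \o F) x @[x --> \oo] --> P (\bigcap_m F m).
  apply: nonincreasing_cvg_mu => //.
  - by apply: le_lt_trans (probability_le1 _ (mF 0%N)) _; rewrite ltry.
  - exact: bigcapT_measurable.
  - move=> n m nm; apply/subsetPset => w H i /iotaP im.
    by apply: H; apply/iotaP; exact: leq_trans nm.
apply: (cvge_ge _ cv); apply: nearW => m /=.
rewrite /F a_indep ?iota_uniq //.
have -> : iota 0 m = index_iota 0 m by rewrite /index_iota subn0.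
rewrite big_mkord.
suff [_ h] : (0 <= \prod_(n < m) (p n)%:E)%E /\ (\prod_(n < m) (p n)%:E <= \prod_(n < m) P (A n))%E.
  apply: le_trans h; rewrite (_ : (\prod_(n < m) (p n)%:E)%E = (\prod_(n < m) p n)%:E) ?lee_fin //.
  by elim/big_ind2: _ => // x1 x2 y1 y2 -> ->.
elim/big_ind2: _ => [|x1 x2 y1 y2 [h1 h2] [h3 h4]|n _].
- by split.
- split; first exact: mule_ge0.
  exact: lee_pmul.
- by rewrite lee_fin p0.
Qed.

Lemma complex_measurable_normal n : complex_measurable (a n).
Proof.
have [m _] := a_normal n; split.
  exact: (measurableT_comp measurable_fst m).
exact: (measurableT_comp measurable_snd m).
Qed.

Lemma gaussian_ball n (s : R) : 0 < s ->
  ((Num.min 1 (s ^+ 2) / 8)%:E <= P ((@complex_coord R \o a n) @^-1` plane_disk s))%E.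
Proof.
move=> s0; have [s1|s1] := leP (s ^+ 2) 1.
  apply: gaussian_small_ball => //.
  by rewrite -(@ler_pXn2r _ 2) ?nnegrE ?(ltW s0) // expr1n.
apply: le_trans (_ : P ((@complex_coord R \o a n) @^-1` plane_disk 1) <= _)%E.
  by have := gaussian_small_ball (a_normal n) ltr01 (lexx 1); rewrite expr1n.
have m1 e : measurable ((@complex_coord R \o a n) @^-1` plane_disk e).
  by rewrite -[X in measurable X]setTI; apply: (a_normal n).1 => //; exact: measurable_plane_disk.
apply: le_measure; rewrite ?inE //.
move=> w; rewrite /plane_disk /= expr1n => h; apply: le_trans h _; exact: ltW.
Qed.

Lemma gaussian_far_ball n (s : R) : 0 < s -> 4 * n.+2%:R ^+ 2 <= s ^+ 2 ->
  ((1 - (n.+2%:R ^+ 2)^-1)%:E <= P ((@complex_coord R \o a n) @^-1` plane_disk s))%E.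
Proof.
move=> s0 ns; apply: le_trans (gaussian_large_ball (a_normal n) s).
rewrite lee_fin lerD2l lerN2 mulNr expRN.
have n0 : 0 < n.+2%:R ^+ 2 :> R by rewrite exprn_gt0 // ltr0n.
have h : 2 * n.+2%:R ^+ 2 <= expR (s ^+ 2 / 2).
  apply: le_trans (expR_ge1Dx _); lra.
rewrite -[X in X * _]invrK -invfM lef_pV2 ?posrE ?mulr_gt0 ?invr_gt0 ?expR_gt0 //; lra.
Qed.

Lemma dominant_event_zeros r N (x : R) w : 0 < r -> N%:R - 1 < x -> x <= N%:R ->
  1 <= normc (a N w) -> (forall n, n != N -> normc (a n w) <= threshold r N n) ->
  (x%:E <= zero_count (planar_GAF a w) r)%E.
Proof.
move=> r0 Nx xN aN an.
pose c : nat -> R[i] := fun n => a n w / (Num.sqrt n`!%:R)%:C%C.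
have f0 n : 0 < Num.sqrt n`!%:R :> R by rewrite sqrtr_gt0 ltr0n fact_gt0.
have cE n : normc (c n) * r ^+ n = normc (a n w) * gaf_weight r n.
  by rewrite /c normcM normcV normc_real gtr0_norm // /gaf_weight mulrAC mulrA.
have [Dw|nD] := pselect (converges_in_disk r c); last first.
  by rewrite /planar_GAF zero_count_divergent // leey.
apply/(zero_count_geP Dw Nx xN).
have gN := gaf_weight_gt0 N r0.
apply: (@dominant_coefficient_zeros _ _ _ _ ((1 - share N) * gaf_weight r N)) => //.
  move=> M; apply: le_trans (ler_wpM2r (ltW gN) (sum_share_but N M)).
  rewrite mulr_suml; apply: ler_sum => n nN; rewrite cE.
  apply: le_trans (ler_wpM2r (ltW (gaf_weight_gt0 n r0)) (an n nN)) _.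
  by rewrite /threshold mulrA mulfVK // gt_eqF // gaf_weight_gt0.
rewrite cE mulrBl mul1r; apply: (@lt_le_trans _ _ (gaf_weight r N)).
  by rewrite ltrBlDr ltrDl mulr_gt0 // share_gt0.
by rewrite ler_peMl // ltW.
Qed.

(** A term is either forced below its threshold, at the cost [L n], or its
    threshold is so large that it is exceeded with probability at most
    1 / (n + 2)^2. The far factors 1 - 1 / (n + 2)^2 multiply to at least 1/2. *)
Lemma zero_count_prob_ge r N (x : R) (L : nat -> R) (Ltot : R) :
  0 < r -> N%:R - 1 < x -> x <= N%:R ->
  (forall n, 0 <= L n) -> (forall m, \sum_(n < m) L n <= Ltot) ->
  expR (- L N) <= outer_prob R ->
  (forall n, n != N ->
     expR (- L n) <= Num.min 1 (threshold r N n ^+ 2) / 8 \/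
     4 * n.+2%:R ^+ 2 <= threshold r N n ^+ 2) ->
  ((expR (- Ltot) / 2)%:E <= P [set w | (x%:E <= zero_count (planar_GAF a w) r)%E])%E.
Proof.
move=> r0 Nx xN L0 LS LN Ln.
pose B n : set (mR * mR) := if n == N then @plane_outside R else plane_disk (threshold r N n).
have mB n : measurable (B n).
  rewrite /B; case: ifP => _; first exact: measurable_plane_outside.
  exact: measurable_plane_disk.
(* all factors are bounded below in the common form u n * expR (- L n) *)
pose u n : R := 1 - (n.+2%:R ^+ 2)^-1.
have u01 n : 0 <= u n <= 1.
  have h : 1 <= n.+2%:R ^+ 2 :> R by rewrite exprn_ege1 // ler1n.
  have h0 : 0 < n.+2%:R ^+ 2 :> R by rewrite exprn_gt0 // ltr0n.
  rewrite /u subr_ge0 gerBl invr_ge0 (ltW h0) andbT.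
  by rewrite invf_le1.
have uL n : u n * expR (- L n) <= expR (- L n).
  by rewrite ler_piMl ?expR_ge0 //; have /andP[] := u01 n.
have Lu n : u n * expR (- L n) <= u n.
  rewrite ler_piMr //; first by have /andP[] := u01 n.
  by rewrite expR_le1 oppr_le0.
have main : ((expR (- Ltot) / 2)%:E <=
    P (\bigcap_n ((@complex_coord R \o a n) @^-1` B n)))%E.
  apply: (independent_bigcap (p := fun n => u n * expR (- L n))) => // [n|n|m].
  - by rewrite mulr_ge0 ?expR_ge0 //; have /andP[] := u01 n.
  - have [->|nN] := eqVneq n N.
      rewrite /B eqxx; apply: le_trans (gaussian_outer (a_normal N)).
      by rewrite lee_fin; apply: le_trans (uL N) LN.
    rewrite /B (negbTE nN); have t0 := threshold_gt0 N n r0.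
    have [h|h] := Ln n nN.
      by apply: le_trans (gaussian_ball n t0); rewrite lee_fin; apply: le_trans (uL n) h.
    by apply: le_trans (gaussian_far_ball t0 h); rewrite lee_fin.
  - rewrite big_split /= -expR_sum mulrC sumrN.
    apply: ler_pM; rewrite ?expR_ge0 ?invr_ge0 ?ler0n ?ler_expR ?lerN2 //.
      exact: prod_share_far.
    exact: LS.
apply: le_trans main _; apply: le_measure; rewrite ?inE.
- apply: bigcapT_measurable => n; rewrite -[X in measurable X]setTI.
  exact: (a_normal n).1.
- apply: (@measurable_zero_count_ge R _ T (fun n w => a n w / (Num.sqrt n`!%:R)%:C%C) r x N) => // n.
  apply: complex_measurableM; first exact: complex_measurable_normal.
  exact: complex_measurable_cst.
move=> w H /=; apply: (dominant_event_zeros r0 Nx xN).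
  have := H N I; rewrite /B eqxx /plane_outside /= -normc_sqr => h.
  by rewrite -(@ler_pXn2r _ 2) ?nnegrE ?normc_ge0 // expr1n.
move=> n nN; have := H n I; rewrite /B (negbTE nN) /plane_disk /= -normc_sqr => h.
by rewrite -(@ler_pXn2r _ 2) ?nnegrE ?normc_ge0 // ltW // threshold_gt0.
Qed.

End gaf.
End one_dominant_term.

(** * Weights, thresholds and sums *)

Section weights.
Context (R : realType).
Implicit Types (r : R) (n N k m : nat).

Lemma gaf_weight_sqrS r n :
  gaf_weight r n.+1 ^+ 2 = gaf_weight r n ^+ 2 * (r ^+ 2 / n.+1%:R).
Proof.
have sq k : gaf_weight r k ^+ 2 = (r ^+ 2) ^+ k / k`!%:R.
  by rewrite /gaf_weight expr_div_n sqr_sqrtr ?ler0n // -!exprM mulnC.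
by rewrite !sq exprSr factS natrM invfM [_^-1 / _]mulrC mulrACA.
Qed.

Definition below_exponent r (V : R) k : R := k%:R * (V - k%:R) / (2 * r ^+ 2).

(** One step down multiplies the squared weight by j / r^2, which is at most
    exp (j / r^2 - 1); the exponents add up to a quadratic function of [k]. *)
Lemma gaf_weight_below r N k : 0 < r -> (k <= N)%N ->
  gaf_weight r (N - k) ^+ 2 <= gaf_weight r N ^+ 2 *
    expR (below_exponent r (2 * (N%:R - r ^+ 2) + 1) k).
Proof.
move=> r0; have r20 : 0 < r ^+ 2 by rewrite exprn_gt0.
elim: k => [|k IH] kN.
  by rewrite subn0 /below_exponent !mul0r expR0 mulr1.
have kN' := ltnW kN.
have Nk : (N - k = (N - k.+1).+1)%N by rewrite subnSK.
have nk0 : 0 < (N - k)%:R :> R by rewrite ltr0n subn_gt0.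
have step : gaf_weight r (N - k.+1) ^+ 2 = gaf_weight r (N - k) ^+ 2 * ((N - k)%:R / r ^+ 2).
  rewrite [in gaf_weight r (N - k)]Nk gaf_weight_sqrS -Nk.
  by field; rewrite !gt_eqF.
rewrite step; apply: le_trans (ler_wpM2r _ (IH kN')) _; first by rewrite divr_ge0 // ltW.
rewrite -[leLHS]mulrA ler_wpM2l ?sqr_ge0 //.
have -> : below_exponent r (2 * (N%:R - r ^+ 2) + 1) k.+1 =
   below_exponent r (2 * (N%:R - r ^+ 2) + 1) k + ((N - k)%:R / r ^+ 2 - 1).
  by rewrite /below_exponent natrB // -natr1; field; rewrite gt_eqF.
rewrite expRD ler_wpM2l ?expR_ge0 //.
by have := expR_ge1Dx ((N - k)%:R / r ^+ 2 - 1); rewrite addrC subrK.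
Qed.

(** One step up multiplies the squared weight by at most
    r^2 / N <= exp (- (N - r^2) / N), and N <= 2 r^2. *)
Lemma gaf_weight_above r N k : 0 < r -> r ^+ 2 <= N%:R -> N%:R <= 2 * r ^+ 2 ->
  gaf_weight r (N + k) ^+ 2 <= gaf_weight r N ^+ 2 *
    expR (- (k%:R * (N%:R - r ^+ 2) / (2 * r ^+ 2))).
Proof.
move=> r0 rN Nr; have r20 : 0 < r ^+ 2 by rewrite exprn_gt0.
have N0 : 0 < N%:R :> R by apply: lt_le_trans rN.
elim: k => [|k IH]; first by rewrite addn0 !mul0r oppr0 expR0 mulr1.
rewrite addnS gaf_weight_sqrS; apply: le_trans (ler_wpM2r _ IH) _.
  by rewrite divr_ge0 // ltW.
rewrite -[leLHS]mulrA ler_wpM2l ?sqr_ge0 //.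
have -> : - (k.+1%:R * (N%:R - r ^+ 2) / (2 * r ^+ 2)) =
   - (k%:R * (N%:R - r ^+ 2) / (2 * r ^+ 2)) + - ((N%:R - r ^+ 2) / (2 * r ^+ 2)).
  by rewrite -natr1; field; rewrite gt_eqF.
rewrite expRD ler_wpM2l ?expR_ge0 //.
apply: (@le_trans _ _ (r ^+ 2 / N%:R)).
  rewrite ler_wpM2l ?(ltW r20) // lef_pV2 ?posrE // ler_nat.
  by rewrite -addnS leq_addr.
have h : r ^+ 2 / N%:R <= expR (r ^+ 2 / N%:R - 1).
  by have := expR_ge1Dx (r ^+ 2 / N%:R - 1); rewrite addrC subrK.
apply: (le_trans h); rewrite ler_expR -[leLHS]opprK lerN2.
have -> : - (r ^+ 2 / N%:R - 1) = (N%:R - r ^+ 2) / N%:R by field; rewrite gt_eqF.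
by rewrite ler_wpM2l ?subr_ge0 // lef_pV2 ?posrE // mulr_gt0.
Qed.

Lemma share_sqr_ge n : n.+2%:R ^- 4 <= share R n ^+ 2.
Proof.
rewrite /share [leRHS]exprVn lef_pV2 ?posrE ?exprn_gt0 ?mulr_gt0 ?ltr0n //.
have -> : (n.+2%:R : R) ^+ 4 = (n.+2%:R * n.+2%:R) ^+ 2 by ring.
rewrite lerXn2r ?nnegrE ?mulr_ge0 ?ler0n // ler_wpM2r ?ler0n //.
by rewrite ler_nat.
Qed.

Lemma threshold_sqr_ge r N n (e : R) : 0 < r -> 
  gaf_weight r n ^+ 2 <= gaf_weight r N ^+ 2 * expR e ->
  n.+2%:R ^- 4 * expR (- e) <= threshold r N n ^+ 2.
Proof.
move=> r0 h; rewrite /threshold exprMn.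
apply: ler_pM; rewrite ?expR_ge0 ?share_sqr_ge //.
rewrite expr_div_n ler_pdivlMr; last by rewrite exprn_gt0 // gaf_weight_gt0.
by rewrite mulrC expRN ler_pdivrMr ?expR_gt0.
Qed.

Lemma expR_ln_nat n k : expR (k%:R * ln (n.+1%:R : R)) = n.+1%:R ^+ k.
Proof. by rewrite mulrC mulr_natr -mulr_natl expRM_natl lnK // posrE ltr0n. Qed.

Lemma threshold_near r N n (C Lam : R) : 0 < r -> 0 <= C -> 7 * ln n.+2%:R <= Lam ->
  gaf_weight r n ^+ 2 <= gaf_weight r N ^+ 2 * expR C ->
  expR (- (C + Lam)) <= Num.min 1 (threshold r N n ^+ 2) / 8.
Proof.
move=> r0 C0 hL /(threshold_sqr_ge r0) h.
have n1 : 1 <= n.+2%:R :> R by rewrite ler1n.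
have n0 : 0 < n.+2%:R :> R by rewrite ltr0n.
have q0 : 0 <= n.+2%:R ^- 4 :> R by rewrite invr_ge0 exprn_ge0 // ltW.
have h1 : n.+2%:R ^- 4 * expR (- C) <= Num.min 1 (threshold r N n ^+ 2).
  rewrite le_min h andbT; apply: mulr_ile1; rewrite ?expR_ge0 //.
    by rewrite invf_le1 ?exprn_gt0 // exprn_ege1.
  by rewrite expR_le1 oppr_le0.
rewrite ler_pdivlMr //; apply: le_trans h1.
rewrite opprD expRD -mulrA mulrC ler_wpM2r ?expR_ge0 //.
have -> : n.+2%:R ^- 4 = n.+2%:R ^- 7 * n.+2%:R ^+ 3 :> R.
  by field; rewrite gt_eqF.
apply: ler_pM; rewrite ?expR_ge0 //.
  by rewrite -expR_ln_nat -expRN ler_expR lerN2.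
have -> : 8 = 2 ^+ 3 :> R by ring.
by rewrite lerXn2r ?nnegrE ?ler0n // ler_nat.
Qed.

Lemma threshold_far r N n : 0 < r ->
  gaf_weight r n ^+ 2 <= gaf_weight r N ^+ 2 * expR (- (8 * ln n.+2%:R)) ->
  4 * n.+2%:R ^+ 2 <= threshold r N n ^+ 2.
Proof.
move=> r0 /(threshold_sqr_ge r0); apply: le_trans; rewrite opprK expR_ln_nat.
have n0 : 0 < n.+2%:R :> R by rewrite ltr0n.
have -> : n.+2%:R ^- 4 * n.+2%:R ^+ 8 = n.+2%:R ^+ 2 * n.+2%:R ^+ 2 :> R.
  by field; rewrite gt_eqF.
rewrite ler_wpM2r ?sqr_ge0 //.
have -> : 4 = 2 ^+ 2 :> R by ring.
by rewrite lerXn2r ?nnegrE ?ler0n // ler_nat.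
Qed.

Lemma sum_below_closed (V : R) M : M%:R - 1 <= V -> 
  \sum_(k < M) Num.max 0 (k%:R * (V - k%:R)) = M%:R * (M%:R - 1) * (3 * V - 2 * M%:R + 1) / 6.
Proof.
elim: M => [|M IH] MV; first by rewrite big_ord0 !mul0r.
rewrite -natr1 in MV.
have M0 : 0 <= M%:R :> R by rewrite ler0n.
rewrite big_ord_recr /= IH; last by lra.
rewrite max_r; last by rewrite mulr_ge0 //; lra.
by rewrite -natr1; field.
Qed.

(** The sum follows its closed form while its terms are positive, and stays
    constant from V on. *)
Lemma sum_below_le (V : R) M : 0 <= V ->
  \sum_(k < M) Num.max 0 (k%:R * (V - k%:R)) <= (V ^+ 3 + 3 * V ^+ 2) / 6.
Proof.
move=> V0; elim: M => [|M IH].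
  by rewrite big_ord0 divr_ge0 // addr_ge0 ?mulr_ge0 ?exprn_ge0.
have M0 : 0 <= M%:R :> R by rewrite ler0n.
have [MV|VM] := leP M%:R V; last first.
  rewrite big_ord_recr /= max_l ?addr0 //.
  by rewrite mulr_ge0_le0 // subr_le0 ltW.
rewrite sum_below_closed; last by rewrite -natr1; lra.
rewrite -natr1 addrK; move: (M%:R : R) M0 MV => g g0 gV.
rewrite ler_pM2r ?invr_gt0 //.
rewrite -subr_ge0.
have -> : V ^+ 3 + 3 * V ^+ 2 - (g + 1) * g * (3 * V - 2 * (g + 1) + 1) =
  (V - g) ^+ 2 * (V + 2 * g) + (3 * V * (V - g) + 3 * g ^+ 2 + g) by ring.
by rewrite !addr_ge0 ?mulr_ge0 ?sqr_ge0 ?subr_ge0 //; lra.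
Qed.

Lemma sum_window (A B m : nat) (Lam : R) : (A <= B)%N -> 0 <= Lam ->
  \sum_(n < m) (if (A <= n <= B)%N then Lam else 0) <= (B - A).+1%:R * Lam.
Proof.
move=> AB L0.
have -> : \sum_(n < m) (if (A <= n <= B)%N then Lam else 0) = (minn m B.+1 - minn m A)%:R * Lam.
  elim: m => [|m IH]; first by rewrite big_ord0 !min0n mul0r.
  rewrite big_ord_recr /= IH.
  case: ifP => h.
    rewrite -[X in _ + X]mul1r -mulrDl natr1; congr (_%:R * _); lia.
  rewrite addr0; congr (_%:R * _); lia.
rewrite ler_wpM2r // ler_nat; lia.
Qed.

Lemma sum_reflect (G : nat -> R) N m : (forall k, 0 <= G k) ->
  \sum_(n < m) (if (n <= N)%N then G (N - n)%N else 0) <= \sum_(k < N.+1) G k.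
Proof.
move=> G0.
have F0 n : 0 <= (if (n <= N)%N then G (N - n)%N else 0) by case: ifP.
apply: (@le_trans _ _ (\sum_(n < m + N.+1) (if (n <= N)%N then G (N - n)%N else 0))).
  by rewrite [leRHS]big_split_ord /= lerDl sumr_ge0.
rewrite addnC [leLHS]big_split_ord /= [X in _ + X]big1 ?addr0; last first.
  by move=> n _; rewrite ifF //; apply/negbTE; rewrite -ltnNge ltnS leq_addr.
rewrite (reindex_inj rev_ord_inj) /= le_eqVlt; apply/orP; left; apply/eqP.
apply: eq_bigr => k _; rewrite subSS leq_subr subKn //.
by rewrite -ltnS.
Qed.

End weights.

(** * The overcrowding probability at a given radius *)

Section window.
Implicit Types (N m n : nat).
Local Open Scope nat_scope.

Fact window_nonempty N m : N - m <= N + m. Proof. lia. Qed.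

Fact window_size N m : ((N + m) - (N - m)).+1 <= m.*2.+1. Proof. lia. Qed.

Fact window_below N m n : n <= N -> N - n <= m -> N - m <= n <= N + m.
Proof. lia. Qed.

Fact window_above N m n : N < n -> n - N <= m -> N - m <= n <= N + m.
Proof. lia. Qed.

End window.

Section overcrowding.
Context (R : realType) (d : measure_display) (T : measurableType d)
  (P : probability T R) (a : nat -> T -> R[i]).
Context (a_normal : forall n, standard_complex_normal P (a n))
  (a_indep : mutually_independent P a).

(** The window consists of the indices within [m1] of [N]. Inside, each term
    pays 7 log (N + m1 + 2) for its share and, below [N], the positive part of
    the exponent of [gaf_weight_below]. Outside, the squared weights are below
    those of [N] by the factor (n + 2)^8, which makes the thresholds large. *)
Lemma overcrowding_at_radius (r x : R) (N m1 : nat) :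
  let U := N%:R - r ^+ 2 in let V := 2 * U + 1 in
  0 < r -> N%:R - 1 < x -> x <= N%:R -> 32 <= U -> U <= r ^+ 2 ->
  2 * V <= m1%:R -> 8 * ln N.+2%:R <= U ^+ 2 / r ^+ 2 ->
  ((expR (- (- ln (outer_prob R) + m1.*2.+1%:R * (7 * ln (N + m1).+2%:R)
      + (V ^+ 3 + 3 * V ^+ 2) / (12 * r ^+ 2))) / 2)%:E <=
   P [set w | (x%:E <= zero_count (planar_GAF a w) r)%E])%E.
Proof.
move=> U V r0 Nx xN U32 Ur Vm lnN.
have r20 : 0 < r ^+ 2 by rewrite exprn_gt0.
have V0 : 0 <= V by rewrite /V; lra.
set L0 := - ln (outer_prob R); set Lam := 7 * ln (N + m1).+2%:R.
have L00 : 0 <= L0 by rewrite oppr_ge0 ln_le0 // outer_prob_le1.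
have Lam0 : 0 <= Lam by rewrite mulr_ge0 // ln_ge0 // ler1n.
pose G k := Num.max 0 (k%:R * (V - k%:R)) / (2 * r ^+ 2).
have G0 k : 0 <= G k.
  by apply: divr_ge0; [rewrite le_max lexx|rewrite mulr_ge0 // ltW].
(* the cost of the dominant term, of the shares in the window, and of pushing
   the terms below N under the dominant one *)
pose L n := (if (N <= n <= N)%N then L0 else 0) +
  (if (N - m1 <= n <= N + m1)%N then Lam else 0) +
  (if (n <= N)%N then G (N - n)%N else 0).
have l1 n : 0 <= (if (N <= n <= N)%N then L0 else 0) by case: ifP.
have l2 n : 0 <= (if (N - m1 <= n <= N + m1)%N then Lam else 0) by case: ifP.
have l3 n : 0 <= (if (n <= N)%N then G (N - n)%N else 0) by case: ifP.
have lnmono (i j : nat) : (i <= j)%N -> ln i.+2%:R <= ln j.+2%:R :> R.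
  by move=> ij; rewrite ler_ln ?posrE ?ltr0n // ler_nat !ltnS.
apply: (zero_count_prob_ge a_normal a_indep r0 Nx xN (L := L)).
- by move=> n; rewrite /L !addr_ge0.
- move=> m; rewrite /L !big_split /=; apply: lerD; first apply: lerD.
  + by apply: le_trans (sum_window m (leqnn N) L00) _; rewrite subnn mul1r.
  + apply: le_trans (sum_window m (window_nonempty N m1) Lam0) _.
    by rewrite ler_wpM2r // ler_nat window_size.
  + apply: le_trans (sum_reflect N m G0) _.
    rewrite /G -mulr_suml.
    apply: le_trans (ler_wpM2r _ (sum_below_le N.+1 V0)) _.
      by rewrite invr_ge0 mulr_ge0 // ltW.
    by rewrite le_eqVlt; apply/orP; left; apply/eqP; field; rewrite gt_eqF.
- have -> : outer_prob R = expR (- L0) by rewrite opprK lnK // posrE outer_prob_gt0.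
  rewrite ler_expR lerN2 /L leqnn /= -addrA lerDl.
  by apply: addr_ge0; [exact: l2|exact: G0].
move=> n nN.
have LE : L n = (if (N - m1 <= n <= N + m1)%N then Lam else 0) +
   (if (n <= N)%N then G (N - n)%N else 0).
  by rewrite /L ifF ?add0r // -eqn_leq eq_sym (negbTE nN).
have [nlt|ngt] := leqP n N.
  set k := (N - n)%N; have nE : n = (N - k)%N by rewrite /k subKn.
  have kN : (k <= N)%N by rewrite leq_subr.
  have below := gaf_weight_below r0 kN; rewrite -nE -/U -/V in below.
  have [km|mk] := leqP k m1; [left|right].
    rewrite LE nlt (window_below nlt km) -/k.
    rewrite [Lam + _]addrC; apply: threshold_near => //.
      by rewrite ler_wpM2l // lnmono // (leq_trans nlt) // leq_addr.
    apply: le_trans below _; rewrite ler_wpM2l ?sqr_ge0 // ler_expR.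
    by rewrite ler_wpM2r ?le_max ?lexx ?orbT // invr_ge0 mulr_ge0 // ltW.
  apply: threshold_far => //; apply: le_trans below _.
  rewrite ler_wpM2l ?sqr_ge0 // ler_expR.
  have k2V : 2 * V <= k%:R by apply: le_trans Vm _; rewrite ler_nat ltnW.
  rewrite /below_exponent lerNr -mulNr.
  have h1 : 8 * ln n.+2%:R <= 8 * ln N.+2%:R :> R by rewrite ler_pM2l ?ltr0n // lnmono.
  apply: (le_trans h1); apply: (le_trans lnN).
  rewrite ler_pdivlMr ?mulr_gt0 // mulrCA divfK ?gt_eqF //.
  move: (k%:R : R) k2V => t tV.
  have h2 : U ^+ 2 <= V ^+ 2 by rewrite lerXn2r ?nnegrE // /V; lra.
  nra.
set k := (n - N)%N; have nE : n = (N + k)%N by rewrite /k subnKC // ltnW.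
have rN : r ^+ 2 <= N%:R by rewrite -subr_ge0 -/U; lra.
have Nr : N%:R <= 2 * r ^+ 2.
  have -> : N%:R = U + r ^+ 2 by rewrite /U subrK.
  by lra.
have above := gaf_weight_above k r0 rN Nr; rewrite -nE -/U in above.
have kU0 : 0 <= k%:R * U / (2 * r ^+ 2).
  by rewrite divr_ge0 ?mulr_ge0 //; lra.
have [km|mk] := leqP k m1; [left|right].
  rewrite LE (window_above ngt km) leqNgt ngt /= addrC; apply: threshold_near => //.
    by rewrite ler_wpM2l // lnmono // nE leq_add2l.
  apply: le_trans above _; rewrite ler_wpM2l ?sqr_ge0 // ler_expR; lra.
apply: threshold_far => //; apply: le_trans above _.
rewrite ler_wpM2l ?sqr_ge0 // ler_expR lerN2.
have k2V : 2 * V <= k%:R by apply: le_trans Vm _; rewrite ler_nat ltnW.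
have N20 : 0 < N.+2%:R :> R by rewrite ltr0n.
(* half of the exponent pays for ln (N + 2), and the other half, since U >= 32,
   for ln (1 + k / (N + 2)) <= k / (N + 2) *)
have hln : ln n.+2%:R <= ln N.+2%:R + k%:R / N.+2%:R :> R.
  have -> : n.+2%:R = N.+2%:R * (1 + k%:R / N.+2%:R) :> R.
    by rewrite mulrDr mulr1 mulrCA mulfV ?gt_eqF // mulr1 -natrD nE.
  have pk : 0 <= k%:R / N.+2%:R :> R by rewrite divr_ge0.
  have p1 : 0 < 1 + k%:R / N.+2%:R :> R by apply: ltr_pwDl.
  rewrite lnM ?posrE // lerD2l; apply: le_ln1Dx.
  by apply: lt_le_trans pk; rewrite ltrN10.
have h1 : k%:R / N.+2%:R <= k%:R / r ^+ 2 :> R.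
  rewrite ler_wpM2l // lef_pV2 ?posrE //; apply: le_trans rN _.
  by rewrite ler_nat (leq_trans (leqnSn N)).
have h2 : 8 * ln n.+2%:R <= U ^+ 2 / r ^+ 2 + 8 * (k%:R / r ^+ 2).
  by move: hln h1 lnN; move: (ln _) (ln _) (_ / N.+2%:R) (_ / r ^+ 2) => A B C D; lra.
apply: (le_trans h2).
move: (k%:R : R) k2V => t; rewrite /V => tV.
have -> : U ^+ 2 / r ^+ 2 + 8 * (t / r ^+ 2) = (U ^+ 2 + 8 * t) / r ^+ 2 by field; rewrite gt_eqF.
have -> : t * U / (2 * r ^+ 2) = t * U / 2 / r ^+ 2 by field; rewrite gt_eqF.
rewrite ler_pM2r ?invr_gt0 //; nra.
Qed.

End overcrowding.

(** * Asymptotics *)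

Section asymptotics.
Context (R : realType).
Implicit Types (r : R).

Lemma ln_le_powR (delta K : R) : 0 < delta ->
  \forall r \near +oo, K * ln r <= r `^ delta.
Proof.
move=> d0; near=> r.
have r0 : 0 < r by near: r; exact: nbhs_pinfty_gt.
have hr : expR (4 * `|K| / delta ^+ 2) <= r by near: r; exact: nbhs_pinfty_ge.
have hl : 4 * `|K| / delta ^+ 2 <= ln r by rewrite -[leLHS]expRK ler_ln ?posrE ?expR_gt0.
have d20 : 0 < delta ^+ 2 by rewrite exprn_gt0.
have l0 : 0 <= ln r by apply: le_trans hl; rewrite divr_ge0 ?mulr_ge0 // ltW.
rewrite /powR gt_eqF //.
have -> : expR (delta * ln r) = expR (delta * ln r / 2) ^+ 2.
  by rewrite -expRM_natl; congr expR; field.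
have h : delta * ln r / 2 <= expR (delta * ln r / 2).
  by apply: le_trans (expR_ge1Dx _); rewrite lerDr.
have p0 : 0 <= delta * ln r / 2 by rewrite divr_ge0 ?mulr_ge0 // ltW.
apply: le_trans (_ : (delta * ln r / 2) ^+ 2 <= _); last by rewrite lerXn2r ?nnegrE ?expR_ge0.
have -> : (delta * ln r / 2) ^+ 2 = (delta ^+ 2 * ln r / 4) * ln r by field.
rewrite ler_wpM2r //; apply: le_trans (ler_norm K) _.
by move: hl; rewrite ler_pdivrMr // => hl; lra.
Unshelve. all: by end_near. Qed.

(** The cubic term is at most 5/6 of the target as V is close to 2 T; the
    remaining sixth absorbs the logarithmic terms. *)
Lemma cost_le (r T L0 : R) (N m1 : nat) :
  let U := N%:R - r ^+ 2 in let V := 2 * U + 1 in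
  0 <= L0 -> 7 <= r -> 1 <= ln r -> 100 <= T -> T + 1 <= r ^+ 2 ->
  6 * (L0 + 190) * ln r <= T ^+ 2 / r ^+ 2 -> T <= U -> U <= T + 1 ->
  m1%:R <= 2 * V + 1 ->
  L0 + m1.*2.+1%:R * (7 * ln (N + m1).+2%:R) + (V ^+ 3 + 3 * V ^+ 2) / (12 * r ^+ 2) + 1
    <= T ^+ 3 / r ^+ 2.
Proof.
move=> U V L00 r7 lr T100 Tr hl TU UT m1V.
have r0 : 0 < r by lra.
have r20 : 0 < r ^+ 2 by rewrite exprn_gt0.
have NE : N%:R = U + r ^+ 2 by rewrite /U subrK.
have lnN : ln (N + m1).+2%:R <= 3 * ln r.
  have -> : 3 * ln r = ln (r ^+ 3) by rewrite lnXn // mulr_natl.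
  rewrite ler_ln ?posrE ?exprn_gt0 ?ltr0n // -addn2 !natrD NE.
  have r49 : 49 <= r ^+ 2 by rewrite expr2; nra.
  have r3 : 7 * r ^+ 2 <= r ^+ 3 by rewrite (exprS r 2) ler_pM2r.
  by rewrite /V in m1V; lra.
have m1T : m1.*2.+1%:R <= 9 * T.
  rewrite -natr1 -muln2 natrM; rewrite /V in m1V; lra.
have c1 : m1.*2.+1%:R * (7 * ln (N + m1).+2%:R) <= 9 * T * (21 * ln r).
  apply: ler_pM => //; last by lra.
  by rewrite mulr_ge0 // ln_ge0 // ler1n.
have T0 : 0 < T by lra.
have V1 : V <= 21 / 10 * T by rewrite /V; lra.
have V0 : 0 <= V by rewrite /V; lra.
have c2 : (V ^+ 3 + 3 * V ^+ 2) / (12 * r ^+ 2) <= 5 / 6 * (T ^+ 3 / r ^+ 2).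
  have -> : 5 / 6 * (T ^+ 3 / r ^+ 2) = (10 * T ^+ 3) / (12 * r ^+ 2) by field; rewrite gt_eqF.
  rewrite ler_pM2r ?invr_gt0 ?mulr_gt0 //.
  have v2 : V ^+ 2 <= 9 / 2 * T ^+ 2.
    apply: le_trans (_ : (21 / 10 * T) ^+ 2 <= _).
      by rewrite lerXn2r ?nnegrE //; lra.
    by rewrite exprMn ler_wpM2r ?sqr_ge0 // expr2; lra.
  have v3 : V ^+ 3 <= 189 / 20 * T ^+ 3.
    have -> : 189 / 20 * T ^+ 3 = (21 / 10 * T) * (9 / 2 * T ^+ 2) by field.
    by rewrite exprS ler_pM ?sqr_ge0.
  have T3 : 100 * T ^+ 2 <= T ^+ 3 by rewrite (exprS T 2) ler_pM2r // exprn_gt0.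
  have T30 : 0 < T ^+ 3 by rewrite exprn_gt0.
  by move: v2 v3 T3 T30; move: (V ^+ 3) (V ^+ 2) (T ^+ 3) (T ^+ 2) => A B C D; lra.
have c3 : T * (6 * (L0 + 190) * ln r) <= T ^+ 3 / r ^+ 2.
  by rewrite (exprS T 2) -[leRHS]mulrA ler_pM2l.
have c4 : L0 + 1 <= T * ((L0 + 1) * ln r).
  have h1 : L0 + 1 <= (L0 + 1) * ln r by rewrite ler_peMr //; lra.
  by apply: (le_trans h1); rewrite ler_peMl //; [apply: mulr_ge0|]; lra.
move: c1 c2 c3 c4; move: (_ * (7 * _)) (_ / (12 * _)) (T ^+ 3 / _) => A B Q c1 c2 c3 c4.
have e : T * ((L0 + 1) * ln r) + 9 * T * (21 * ln r) = T * (6 * (L0 + 190) * ln r) / 6 by field.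
lra.
Qed.

Lemma ex_ceil_nat (x : R) : 0 < x -> exists N : nat, N%:R - 1 < x /\ x <= N%:R.
Proof.
move=> x0; have /andP[h1 h2] := truncn_itv (ltW x0).
have [xE|xn] := eqVneq x (Num.truncn x)%:R.
  by exists (Num.truncn x); rewrite -xE; split => //; rewrite ltrBlDr ltrDl.
exists (Num.truncn x).+1; rewrite -natr1 addrK natr1 (ltW h2); split => //.
by rewrite lt_neqAle eq_sym xn.
Qed.

End asymptotics.

Theorem theorem4 (R : realType) (d : measure_display) (T : measurableType d)
    (P : probability T R) (a : nat -> T -> R[i])
    (a_normal : forall n, standard_complex_normal P (a n))
    (a_indep : mutually_independent P a)
    (alpha : R) (alpha_gt1 : 1 < alpha) (alpha_lt2 : alpha < 2)
    (gamma : R) (gamma_gt0 : 0 < gamma) :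
  exists2 eps : R -> R, eps r @[r --> +oo] --> 0 &
    \forall r \near +oo,
      ((expR (- (gamma ^+ 3 * r `^ (3 * alpha - 2) * (1 + eps r))))%:E <=
       P [set w | ((r ^+ 2 + gamma * r `^ alpha)%:E <=
                   zero_count (planar_GAF a w) r)%E])%E.
Proof.
(* the exponent found is about 2/3 of the one claimed, so no error term is left *)
exists (fun=> 0); first exact: cvg_cst.
set L0 := - ln (outer_prob R).
have L00 : 0 <= L0 by rewrite oppr_ge0 ln_le0 // outer_prob_le1.
near=> r.
have r7 : 7 <= r by near: r; exact: nbhs_pinfty_ge.
have r0 : 0 < r by lra.
have re : expR 1 <= r by near: r; exact: nbhs_pinfty_ge.
have lr : 1 <= ln r by rewrite -[leLHS]expRK ler_ln ?posrE ?expR_gt0.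
have h1 : 100 / gamma * ln r <= r `^ alpha.
  by near: r; apply: ln_le_powR; lra.
have h2 : (gamma + 1) * ln r <= r `^ (2 - alpha).
  by near: r; apply: ln_le_powR; lra.
have h3 : 6 * (L0 + 190) / gamma ^+ 2 * ln r <= r `^ (2 * alpha - 2).
  by near: r; apply: ln_le_powR; lra.
set t := gamma * r `^ alpha; set x := r ^+ 2 + t.
have rne : r != 0 by rewrite gt_eqF.
have pa1 : 1 <= r `^ alpha by rewrite -(powRr0 r) ler_powR //; lra.
have t100 : 100 <= t.
  rewrite /t -ler_pdivrMl // mulrC; apply: le_trans h1.
  by rewrite ler_peMr // divr_ge0 // ltW.
have tr : t + 1 <= r ^+ 2.
  have -> : r ^+ 2 = r `^ alpha * r `^ (2 - alpha).
    by rewrite -powRD ?rne ?implybT // addrC subrK powR_mulrn // ltW.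
  have h2' : gamma + 1 <= r `^ (2 - alpha).
    by apply: le_trans h2; rewrite ler_peMr //; lra.
  have : r `^ alpha * (gamma + 1) <= r `^ alpha * r `^ (2 - alpha).
    by rewrite ler_wpM2l // powR_ge0.
  rewrite /t; lra.
have r20 : 0 < r ^+ 2 by rewrite exprn_gt0.
have t2 : t ^+ 2 / r ^+ 2 = gamma ^+ 2 * r `^ (2 * alpha - 2).
  rewrite /t exprMn -mulrA; congr (_ * _).
  rewrite -(powR_mulrn 2 (powR_ge0 r alpha)) -powRrM powRB ?rne ?implybT //.
  by rewrite (mulrC alpha) (powR_mulrn 2 (ltW r0)).
have t3 : t ^+ 3 / r ^+ 2 = gamma ^+ 3 * r `^ (3 * alpha - 2).
  rewrite /t exprMn -mulrA; congr (_ * _).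
  rewrite -(powR_mulrn 3 (powR_ge0 r alpha)) -powRrM powRB ?rne ?implybT //.
  by rewrite (mulrC alpha) (powR_mulrn 2 (ltW r0)).
have hl : 6 * (L0 + 190) * ln r <= t ^+ 2 / r ^+ 2.
  rewrite t2 -ler_pdivrMl ?exprn_gt0 //; apply: le_trans h3.
  by rewrite le_eqVlt; apply/orP; left; apply/eqP; field; rewrite gt_eqF.
have [N [Nx xN]] := @ex_ceil_nat R x (addr_gt0 r20 (lt_le_trans (ltr0n R 100) t100)).
pose U := N%:R - r ^+ 2; pose V := 2 * U + 1.
have tU : t <= U by rewrite /U lerBrDl.
have Ut : U <= t + 1.
  by rewrite /U lerBlDl addrA -/x -lerBlDr ltW.
pose m1 := (Num.truncn (2 * V)).+1.
have V0 : 0 <= 2 * V by rewrite /V; lra.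
have /andP[m1a m1b] := truncn_itv V0.
have m1V : m1%:R <= 2 * V + 1 by rewrite /m1 -natr1 lerD2r.
have lnN2 : 8 * ln N.+2%:R <= U ^+ 2 / r ^+ 2.
  have NE : N%:R = U + r ^+ 2 by rewrite /U subrK.
  have lnN : ln N.+2%:R <= 3 * ln r.
    have -> : 3 * ln r = ln (r ^+ 3) by rewrite lnXn // mulr_natl.
    rewrite ler_ln ?posrE ?exprn_gt0 ?ltr0n // -addn2 natrD NE.
    have r49 : 49 <= r ^+ 2 by rewrite expr2; nra.
    have r3 : 7 * r ^+ 2 <= r ^+ 3 by rewrite (exprS r 2) ler_pM2r.
    lra.
  have tU2 : t ^+ 2 / r ^+ 2 <= U ^+ 2 / r ^+ 2.
    have t0 : 0 <= t by lra.
    by rewrite ler_pM2r ?invr_gt0 // lerXn2r ?nnegrE // (le_trans t0).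
  apply: le_trans tU2; apply: le_trans hl.
  apply: (@le_trans _ _ (24 * ln r)); first by lra.
  have l0 : 0 < ln r by apply: lt_le_trans lr.
  rewrite ler_pM2r //; lra.
have U32 : 32 <= U by lra.
have UR : U <= r ^+ 2 by lra.
have main := overcrowding_at_radius a_normal a_indep r0 Nx xN U32 UR (ltW m1b) lnN2.
apply: le_trans main.
rewrite lee_fin addr0 mulr1 -t3.
(* the factor 1/2 of the far indices costs at most 1 in the exponent *)
have half : expR (- 1) <= 2^-1 :> R.
  rewrite expRN lef_pV2 ?posrE ?expR_gt0 //.
  by have := expR_ge1Dx (1 : R); lra.
apply: le_trans (ler_wpM2l (expR_ge0 _) half).
rewrite -expRD ler_expR -opprD lerN2.
exact: (cost_le L00 r7 lr t100 tr hl tU Ut m1V).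
Unshelve. all: by end_near. Qed.
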